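(* There are positive constants $c$ and $C$ such that, for all sufficiently large integers $k$, $$c\,k^2\log k\leq T_k\leq C\,k^2\log k.$$ Consequently, $T_k=\Theta(k^2\log k)$.
   Context: For each positive integer $m$, write $[m]=\{1,\ldots,m\}$; $\log$ denotes the natural logarithm. A coloring is equinumerous if every color is used equally often; thus an equinumerous $t$-coloring of $[tn]$ uses each of the $t$ colors exactly $n$ times. An arithmetic progression is understood to have positive common difference, and it is rainbow if its terms have pairwise distinct colors. For each integer $k\geq 3$, $T_k$ is the minimum positive integer $t$ such that, for every positive integer $n$, every equinumerous $t$-coloring of $[tn]$ contains a rainbow $k$-term arithmetic progression. *)

(* Defs.v *)
From HB Require Import structures.
From mathcomp Require Import all_boot all_order all_algebra.
From mathcomp Require Import all_classical all_reals all_analysis.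

Set Implicit Arguments.
Unset Strict Implicit.
Unset Printing Implicit Defensive.

Local Open Scope nat_scope.

Definition interval1 (m : nat) : seq nat := iota 1 m.

(* A t-coloring of [m] = {1, ..., m} is represented by a function on all of
   nat, of which only the values on [m] are ever used. *)
Definition equinumerous (t m : nat) (chi : nat -> 'I_t) : Prop :=
  forall i j : 'I_t,
    count (fun x => chi x == i) (interval1 m)
    = count (fun x => chi x == j) (interval1 m).

Definition arith_prog (a d k : nat) : seq nat :=
  [seq a + i * d | i <- iota 0 k].

Definition has_rainbow_AP (t m k : nat) (chi : nat -> 'I_t) : Prop :=
  exists a d : nat,
    [/\ 0 < d, {subset arith_prog a d k <= interval1 m}
      & uniq [seq chi x | x <- arith_prog a d k]].

Definition forces_rainbow_AP (k t : nat) : Prop :=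
  forall n : nat, 0 < n -> forall chi : nat -> 'I_t,
    equinumerous (t * n) chi -> has_rainbow_AP (t * n) k chi.

Definition is_rainbow_number (k t : nat) : Prop :=
  [/\ 0 < t, forces_rainbow_AP k t
    & forall s : nat, 0 < s -> forces_rainbow_AP k s -> t <= s].

(* The default value 0 is taken only if no positive t forces a rainbow k-term
   progression; so 0 < rainbow_number k says exactly that the minimum exists. *)
Definition rainbow_number (k : nat) : nat :=
  xget 0 [set t | is_rainbow_number k t]%classic.

(* Main.v *)
Require Import Defs.
From HB Require Import structures.
From mathcomp Require Import all_boot all_order all_algebra.
From mathcomp Require Import all_classical all_reals all_analysis.
From mathcomp Require Import fintype finset.
From mathcomp Require Import zify ring lra.
Import Order.TTheory GRing.Theory Num.Theory.
Import numFieldNormedType.Exports.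
Set Implicit Arguments.
Unset Strict Implicit.
Unset Printing Implicit Defensive.

(** Both bounds rest on how the difference [y - x] of two terms of one colour can be
    written as [s * d] with [s < k], where [d] is the common difference of a
    progression through [x] and [y].

    Upper bound. If [d] has no prime factor less than [k], then [s] and [d] are determined
    by [y - x]. Hence, among the progressions with such rough differences, each
    monochromatic pair spoils at most [k], whereas without the restriction on [d] a
    colour class concentrated on multiples of a highly divisible number would spoil many
    more. Rough numbers have density of order [1 / ln k] ([rough_count_lower]), and
    comparing the two counts produces a rainbow progression once [t] exceeds a
    multiple of [k ^ 2 * ln k] ([forces_of_rough_count]). The density is obtained from
    the estimates of Chebyshev and Mertens by an induction that keeps the constant.

    Lower bound. It suffices to use every colour twice, that is, to partition
    [[2 * t]] into pairs so that each [k]-term progression contains a pair. The common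
    differences are at most [X], about [2 * t / k]. A pair at distance a multiple of [D]
    can serve all progressions whose difference [d] divides [D], if [D / d] is small
    compared with [k]. Everything depends on the existence of only [O(X / ln k)]
    numbers [D] such that each [d <= X] divides some [D <= d * k ^ (1/4)]
    ([divisor_cover]); their number is a small multiple of [k] if [t] is a small
    multiple of [k ^ 2 * ln k].

    To construct these [D], partition the primes of each dyadic block into groups and
    replace a squarefree [d] by the product of all groups that it hits. The
    more primes [d] has, the smaller the groups have to be for this product to stay
    below [d * k ^ (1/4)]; the levels [i] of the construction, with at most [2 ^ i] groups
    hit, take care of this. The number of products is bounded as one bounds the number of
    integers composed of given primes ([count_large_sets]): at level [0] the sum of the
    reciprocals of the groups is bounded, and the factor [ln k] is gained as in the
    prime number theorem; at level [i] the sum of reciprocals grows, but having to hit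
    [2 ^ i] groups is so rare that the sum over [i] converges ([squarefree_cover]).

    Given the numbers [D], each of them reserves, in every cell of an appropriate length
    and for every residue in a window modulo [D], two points of the cell in that residue
    class. A progression whose difference [d] divides [D] runs through a cell and meets
    one of these residue classes in all its points in the cell ([not_forces_of_cover]).
    The windows can be placed so that no point is wanted too often
    ([balanced_windows]), and then Hall's theorem assigns disjoint pairs
    ([assign_pairs]). *)

(** * Chebyshev's and Mertens' estimates *)

Local Open Scope nat_scope.

(** Distinct primes are pairwise coprime, so divisibility by each of them gives
    divisibility by their product. *)
Lemma prod_primes_dvdn (r : seq nat) (M : nat) :
  uniq r -> {in r, forall p, prime p /\ p %| M} -> \prod_(p <- r) p %| M.
Proof.
elim: r => [|p r IH] /=; first by rewrite big_nil dvd1n.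
case/andP=> pr ur H; rewrite big_cons Gauss_dvd.
  have [_ ->] := H p (mem_head _ _).
  by apply: IH => // q qr; apply: H; rewrite inE qr orbT.
have [pp _] := H p (mem_head _ _).
rewrite prime_coprime //; apply/negP.
rewrite big_seq; apply: (big_ind (fun m => ~ p %| m)).
- by rewrite dvdn1 => /eqP E; rewrite E in pp.
- by move=> x y nx ny; rewrite Euclid_dvdM // => /orP[].
- move=> q qr; have [pq _] := H q (mem_behead (s := p :: r) qr).
  by rewrite dvdn_prime2 // => /eqP E; rewrite E qr in pr.
Qed.

Lemma prime_dvd_fact p n : prime p -> p %| n`! -> p <= n.
Proof.
move=> pp; elim: n => [|n IH]; first by rewrite fact0 dvdn1 => /eqP E; rewrite E in pp.
by rewrite factS Euclid_dvdM // => /orP[/dvdn_leq-> //|/IH/leqW].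
Qed.

Lemma bin_mid_le h : 'C(h.*2.+1, h) <= 4 ^ h.
Proof.
have : 'C(h.*2.+1, h) + 'C(h.*2.+1, h.+1) <= 2 ^ h.*2.+1.
  have -> : 2 ^ h.*2.+1 = (1 + 1) ^ h.*2.+1 by [].
  rewrite expnDn -(big_mkord xpredT (fun i => 'C(h.*2.+1, i) * (1 ^ (h.*2.+1 - i) * 1 ^ i))).
  rewrite (@big_cat_nat _ _ _ h) //=; last by lia.
  rewrite (@big_cat_nat _ _ _ h.+2 h) //=; try lia.
  by rewrite big_nat_recl // big_nat1 !exp1n !muln1 addnCA leq_addr.
have -> : 'C(h.*2.+1, h.+1) = 'C(h.*2.+1, h).
  by rewrite -bin_sub; last lia; congr 'C(_, _); lia.
by rewrite expnS -(expnM 2 2 h) mul2n; lia.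
Qed.

(** Strong induction: for odd [n = 2h+1], the primes between [h+2] and [n] all
    divide ['C(n, h)], which is at most [4 ^ h]; even [n > 2] are not prime. *)
Lemma primorial_le n : \prod_(1 <= p < n.+1 | prime p) p <= 4 ^ n.
Proof.
have [m] := ubnP n; elim: m n => // m IH [|[|[|n]]] lt_nm.
- by rewrite big_geq.
- by rewrite big_ltn_cond //= big_geq.
- by rewrite big_ltn_cond //= big_ltn_cond //= big_geq.
set N := n.+3; have [oN|eN] := boolP (odd N); last first.
  rewrite big_mkcond big_nat_recr //= -big_mkcond ifN; last first.
    by apply/negP => /even_prime [] // oN; rewrite oN in eN.
  by rewrite muln1; apply: leq_trans (IH _ _) _; rewrite ?leq_exp2l.
pose h := N./2; have EN : N = h.*2.+1 by rewrite /h; lia.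
have h1 : 1 <= h by rewrite /h /N; lia.
rewrite (@big_cat_nat _ _ _ h.+2) //=; last by rewrite EN; lia.
have -> : 4 ^ N = 4 ^ h.+1 * 4 ^ h by rewrite -expnD EN; congr (_ ^ _); lia.
apply: leq_mul; first by apply: IH; lia.
have dv : \prod_(h.+2 <= p < N.+1 | prime p) p %| 'C(N, h).
  rewrite -big_filter; apply: prod_primes_dvdn.
    by rewrite filter_uniq ?iota_uniq.
  move=> p; rewrite mem_filter mem_index_iota => /andP[pp /andP[p1 p2]].
  split => //; have: p %| N`! by rewrite dvdn_fact //; lia.
  rewrite -(@bin_fact N h); last by lia.
  by rewrite Euclid_dvdM // => /orP[] //; rewrite Euclid_dvdM // => /orP[] /(prime_dvd_fact pp); lia.
apply: leq_trans (dvdn_leq _ dv) _; first by rewrite bin_gt0; lia.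
by rewrite EN bin_mid_le.
Qed.

Local Open Scope ring_scope.

Lemma ln_prodn (R : realType) (I : Type) (r : seq I) (P : pred I) (F : I -> nat) :
  (forall i, P i -> (0 < F i)%N) ->
  ln ((\prod_(i <- r | P i) F i)%N%:R : R) = \sum_(i <- r | P i) ln (F i)%:R.
Proof.
move=> F0; suff [] : (0 < \prod_(i <- r | P i) F i)%N /\
  ln ((\prod_(i <- r | P i) F i)%N%:R : R) = \sum_(i <- r | P i) ln (F i)%:R by [].
apply: (big_rec2 (fun (x : nat) (y : R) => (0 < x)%N /\ ln (x%:R : R) = y)).
  by rewrite ln1.
move=> i y1 y2 Pi [y10 <-]; split; first by rewrite muln_gt0 F0.
by rewrite natrM lnM // posrE ltr0n // F0.
Qed.

Lemma lnn_ge0 (R : realType) (n : nat) : 0 <= ln (n%:R : R).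
Proof.
case: n => [|n]; first by rewrite ln0.
by apply: ln_ge0; rewrite ler1n.
Qed.

Definition theta (R : realType) (n : nat) : R :=
  \sum_(1 <= p < n.+1 | prime p) ln p%:R.

Definition mertens_sum (R : realType) (n : nat) : R :=
  \sum_(1 <= p < n.+1 | prime p) ln p%:R / p%:R.

Lemma theta_le (R : realType) n : theta R n <= n%:R * ln 4.
Proof.
rewrite /theta -ln_prodn => [|p /prime_gt0 //].
have -> : n%:R * ln 4 = ln ((4 ^ n)%N%:R : R) by rewrite natrX lnXn // mulr_natl.
rewrite ler_ln ?posrE ?ltr0n ?expn_gt0 //.
  by rewrite ler_nat primorial_le.
by apply: prodn_cond_gt0 => p /prime_gt0.
Qed.

Lemma lnS_diff (R : realType) n : (0 < n)%N ->
  n%:R * (ln (n.+1%:R : R) - ln n%:R) <= 1.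
Proof.
case: n => // n _; rewrite -ln_div ?posrE ?ltr0n //.
have -> : n.+2%:R / n.+1%:R = 1 + n.+1%:R^-1 :> R.
  by rewrite -[n.+2]add1n natrD mulrDl mul1r divff ?pnatr_eq0 // addrC.
rewrite -ler_pdivlMl ?ltr0n // mulr1.
by apply: le_ln1Dx; rewrite (@lt_le_trans _ _ 0) // ?oppr_lt0 // invr_ge0 ler0n.
Qed.

(** The weak form of Stirling's formula, obtained by summing [lnS_diff]. *)
Lemma ln_fact_lower (R : realType) n : n%:R * ln (n%:R : R) - n%:R <= ln (n`!%:R).
Proof.
elim: n => [|[|n] IH]; first by rewrite fact0 ln1 mul0r subr0.
  by rewrite ln1 mulr0 sub0r oppr_le0.
rewrite factS natrM lnM ?posrE ?ltr0n ?fact_gt0 //.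
have Dl := @lnS_diff R n.+1 isT.
have E : n.+2%:R = n.+1%:R + 1 :> R by rewrite natr1.
move: Dl IH E; set y := n.+2%:R; set m := n.+1%:R.
by set a := ln y; set b := ln m; set c := ln _ => Dl IH ->; nra.
Qed.

Lemma ln_fact (R : realType) n :
  ln (n`!%:R : R) = \sum_(1 <= p < n.+1 | prime p) (logn p n`!)%:R * ln p%:R.
Proof.
have nf : (n <= n`!)%N by case: n => // n; rewrite dvdn_leq ?fact_gt0 // dvdn_fact //= leqnn.
have E : n`! = (\prod_(1 <= p < n.+1 | prime p) p ^ logn p n`!)%N.
  rewrite -{1}(partnT (fact_gt0 n)) (widen_partn predT (leqnn _)).
  rewrite (@big_cat_nat _ _ _ n.+1) //= [X in (_ * X)%N = _]big_nat_cond [X in (_ * X)%N = _]big1 ?muln1; last first.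
    move=> p; rewrite andbT => /andP[np _]; case: (boolP (prime p)) => pp; last first.
      by rewrite lognE (negbTE pp).
    rewrite lognE pp fact_gt0 /=; case: ifP => // /(prime_dvd_fact pp); lia.
  rewrite big_ltn // [in RHS]big_mkcond /= lognE /= expn0 mul1n.
  by apply: eq_bigr => p _; case: ifP => // pp; rewrite lognE pp.
rewrite {1}E ln_prodn => [|p pp]; last by rewrite expn_gt0 prime_gt0.
by apply: eq_bigr => p pp; rewrite natrX lnXn ?ltr0n ?prime_gt0 // mulr_natl.
Qed.

Lemma logn_fact_ge p n : prime p -> (n %/ p <= logn p n`!)%N.
Proof.
move=> pp; rewrite logn_fact //; case: n => [|n]; first by rewrite div0n.
by rewrite big_ltn // expn1 leq_addr.
Qed.

(** Legendre's formula bounds the exponent of [p] in [n`!] by the geometric series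
    with sum [n / (p - 1)]. *)
Lemma logn_fact_le p n : prime p -> (p.-1 * logn p n`! <= n)%N.
Proof.
move=> pp; rewrite logn_fact //.
suff H m : (p.-1 * \sum_(1 <= k < m.+1) n %/ p ^ k + n %/ p ^ m <= n)%N.
  by apply: leq_trans (H n); rewrite leq_addr.
elim: m => [|m IH]; first by rewrite big_geq // muln0 add0n expn0 divn1.
rewrite big_nat_recr //= mulnDr -addnA.
have E : (p.-1 * (n %/ p ^ m.+1) + n %/ p ^ m.+1 = n %/ p ^ m.+1 * p)%N.
  by rewrite -mulSnr prednK ?prime_gt0 // mulnC.
rewrite E; apply: leq_trans IH; rewrite leq_add2l.
by rewrite expnSr divnMA leq_trunc_div.
Qed.

(** The first powers of the primes alone contribute to [ln n`!] at least
    [ln p * (n / p - 1)] each, while [ln n`! <= n * ln n]; the total rounding error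
    is [theta n], which is [O(n)] by Chebyshev's bound. *)
Lemma mertens_upper (R : realType) n : (0 < n)%N ->
  mertens_sum R n <= ln n%:R + ln 4.
Proof.
move=> n0; have n0' : 0 < n%:R :> R by rewrite ltr0n.
have up : ln (n`!%:R : R) <= n%:R * ln n%:R.
  rewrite fact_prod big_nat ln_prodn => [|i /andP[]] //.
  have -> : n%:R * ln n%:R = \sum_(1 <= i < n.+1) ln (n%:R : R).
    by rewrite sumr_const_nat subSS subn0 mulr_natl.
  rewrite [leRHS]big_nat; apply: ler_sum => i /andP[i1 i2].
  by rewrite ler_ln ?posrE ?ltr0n // ler_nat.
have key : n%:R * mertens_sum R n <= ln (n`!%:R : R) + theta R n.
  rewrite ln_fact /theta /mertens_sum -big_split mulr_sumr /=.
  apply: ler_sum => p pp; have p0 : 0 < p%:R :> R by rewrite ltr0n prime_gt0.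
  have L := @lnn_ge0 R p.
  rewrite mulrCA -[X in _ + X]mul1r -mulrDl mulrC; apply: ler_wpM2r => //.
  rewrite ler_pdivrMr // natr1 -natrM ler_nat.
  have := @logn_fact_ge p n pp; move/(leq_mul (leqnn p)); have := divn_eq n p.
  have := ltn_pmod n (prime_gt0 pp); nia.
have T := theta_le R n.
by rewrite -(ler_pM2l n0') mulrDr; apply: le_trans key _; apply: lerD.
Qed.

(** With [a = ln (m + 1)] and [b = ln m]: the function [(ln m + 2) / m] decreases fast
    enough for its decrements to dominate the terms [ln m / (m * (m - 1))]. *)
Lemma telescope_step (R : realType) (a b m : R) : 1 <= m -> m * (a - b) <= 1 ->
  a / ((m + 1) * m) <= (b + 2) / m - (a + 2) / (m + 1).
Proof.
move=> m1 D.
have m0 : m != 0 by lra.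
have m0' : m + 1 != 0 by lra.
have -> : (b + 2) / m - (a + 2) / (m + 1) = ((m + 1) * (b + 2) - m * (a + 2)) / ((m + 1) * m).
  by field; rewrite m0 m0'.
apply: ler_wpM2r; first by rewrite invr_ge0 mulr_ge0 //; lra.
have [ab|ab] := leP a b; first by have := ler_wpM2l (le_trans ler01 m1) ab; lra.
have := @ler_wpM2r _ (a - b) _ _ _ m1; rewrite subr_ge0 (ltW ab) => /(_ isT); lra.
Qed.

(** The terms are the differences [ln p / (p - 1) - ln p / p] between the weight that
    Legendre's formula gives to [p] and its weight in Mertens' sum. *)
Lemma sum_ln_excess_le (R : realType) n : (0 < n)%N ->
  \sum_(1 <= p < n.+1 | prime p) ln (p%:R : R) / (p%:R * p.-1%:R)
    <= 2 - (ln n%:R + 2) / n%:R.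
Proof.
elim: n => // -[|n] IH _.
  by rewrite big_ltn_cond //= big_geq // ln1 add0r divr1 subrr.
rewrite big_mkcond big_nat_recr //= -big_mkcond /=.
have {}IH := IH isT.
have step : ln (n.+2%:R : R) / (n.+2%:R * n.+1%:R) <=
   (ln n.+1%:R + 2) / n.+1%:R - (ln n.+2%:R + 2) / n.+2%:R.
  have D := @lnS_diff R n.+1 isT; have E : n.+2%:R = n.+1%:R + 1 :> R by rewrite natr1.
  have m1 : 1 <= n.+1%:R :> R by rewrite ler1n.
  by rewrite E; apply: telescope_step; rewrite -?E.
case: ifP => pn.
  by apply: le_trans (lerD IH step) _; rewrite addrA subrK.
rewrite addr0; apply: le_trans IH _; rewrite lerD2l lerN2 -subr_ge0.
by apply: le_trans step; rewrite divr_ge0 ?lnn_ge0 ?mulr_ge0.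
Qed.

(** By Legendre's formula [ln n`!] is at most [n] times the sum of
    [ln p / (p - 1)], and replacing [p - 1] by [p] costs a bounded amount. *)
Lemma mertens_lower (R : realType) n : (0 < n)%N ->
  ln n%:R - 3 <= mertens_sum R n.
Proof.
move=> n0; have n0' : 0 < n%:R :> R by rewrite ltr0n.
have key : ln (n`!%:R : R) <= n%:R * (mertens_sum R n +
    \sum_(1 <= p < n.+1 | prime p) ln (p%:R : R) / (p%:R * p.-1%:R)).
  rewrite ln_fact /mertens_sum -big_split mulr_sumr /=.
  apply: ler_sum => p pp; have p0 : 0 < p%:R :> R by rewrite ltr0n prime_gt0.
  have p1 : 0 < p.-1%:R :> R by rewrite ltr0n -ltnS prednK ?prime_gt0 // prime_gt1.
  have E : p%:R = p.-1%:R + 1 :> R by rewrite natr1 prednK // prime_gt0.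
  have L := @lnn_ge0 R p.
  have -> : n%:R * (ln p%:R / p%:R + ln p%:R / (p%:R * p.-1%:R)) = n%:R / p.-1%:R * ln p%:R :> R.
    have h1 : p%:R != 0 :> R by rewrite gt_eqF.
    have h2 : p.-1%:R != 0 :> R by rewrite gt_eqF.
    rewrite E in h1 *; set l := ln _; field; rewrite h1 h2 //.
  apply: ler_wpM2r => //; rewrite ler_pdivlMr // -natrM ler_nat mulnC.
  exact: logn_fact_le.
have A := sum_ln_excess_le R n0; have B := ln_fact_lower R n.
have C : 0 <= (ln n%:R + 2) / n%:R :> R by rewrite divr_ge0 // addr_ge0 ?lnn_ge0.
rewrite -(ler_pM2l n0'); have : n%:R * (\sum_(1 <= p < n.+1 | prime p) ln (p%:R : R) / (p%:R * p.-1%:R)) <= n%:R * 2.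
  by apply: ler_wpM2l => //; lra.
move: key B; rewrite !mulrDr; lra.
Qed.

Lemma ln_unbounded (R : realType) (x : R) :
  exists K : nat, (0 < K)%N /\ forall k : nat, (K <= k)%N -> x <= ln k%:R.
Proof.
exists (Num.bound (expR x)).+1; split=> // k Kk.
rewrite -[leLHS]expRK ler_ln ?posrE ?expR_gt0 ?ltr0n //; last by apply: leq_trans Kk.
apply/ltW/(lt_le_trans (archi_boundP (expR_ge0 x))).
by rewrite ler_nat ltnW.
Qed.

(** * The density of rough numbers *)

(** The [k]-rough numbers: those without prime factors less than [k]. *)
Definition rough (k d : nat) : bool := coprime d (k.-1)`!.

Definition rough_count (k X : nat) : nat := count (rough k) (index_iota 1 X.+1).

Lemma rough_prime k p : (0 < k)%N -> prime p -> (k <= p)%N -> rough k p.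
Proof.
by move=> k0 pp kp; rewrite /rough prime_coprime //; apply/negP => /(prime_dvd_fact pp); lia.
Qed.

Lemma rough_coprime k d s : rough k d -> (0 < s < k)%N -> coprime d s.
Proof. by move=> rd sk; apply: coprime_dvdr rd; rewrite dvdn_fact //; lia. Qed.

Lemma roughM k a b : rough k (a * b) = rough k a && rough k b.
Proof. exact: coprimeMl. Qed.

Lemma rough_count_gt0 k X : (0 < X)%N -> (0 < rough_count k X)%N.
Proof.
move=> X0; rewrite -has_count; apply/hasP; exists 1%N; last exact: coprime1n.
by rewrite mem_index_iota.
Qed.

(** Multiplication by a prime [p >= k] sends rough numbers to rough multiples of [p]. *)
Lemma rough_count_dvd k p X : (0 < k)%N -> prime p -> (k <= p)%N ->
  (rough_count k (X %/ p) <=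
     count (fun d => (rough k d && (p %| d))%N) (index_iota 1 X.+1))%N.
Proof.
move=> k0 pp kp; have p0 := prime_gt0 pp.
rewrite /rough_count -!size_filter -(size_map (muln p)).
apply: uniq_leq_size.
  rewrite map_inj_uniq ?filter_uniq ?iota_uniq // => x y /eqP.
  by rewrite eqn_pmul2l // => /eqP.
move=> _ /mapP[m + ->]; rewrite !mem_filter !mem_index_iota => /andP[rm /andP[m1 m2]].
rewrite roughM rough_prime // rm dvdn_mulr //= muln_gt0 p0 m1 /= ltnS.
by move: m2; rewrite ltnS leq_divRL // mulnC.
Qed.

Lemma sum_ln_primes_le (R : realType) (r : seq nat) d : uniq r -> (0 < d)%N ->
  \sum_(p <- r | (prime p && (p %| d))%N) ln (p%:R : R) <= ln d%:R.
Proof.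
move=> ur d0; rewrite -ln_prodn; last by move=> p /andP[/prime_gt0].
have P0 : (0 < \prod_(p <- r | prime p && (p %| d)) p)%N.
  by apply: prodn_cond_gt0 => p /andP[/prime_gt0].
rewrite ler_ln ?posrE ?ltr0n // ler_nat dvdn_leq //.
rewrite -big_filter prod_primes_dvdn ?filter_uniq // => p.
by rewrite mem_filter => /andP[/andP[]].
Qed.

(** Sum [ln d] over the rough [d <= X]. Since [ln d] is at least the sum of [ln p]
    over the primes [p] dividing [d], exchanging the sums and writing [d = p * m]
    expresses the count up to [X] through the counts up to [X / p]. *)
Lemma rough_count_log (R : realType) k X : (0 < k)%N ->
  \sum_(k <= p < X.+1 | prime p) ln (p%:R : R) * (rough_count k (X %/ p))%:R
   <= (rough_count k X)%:R * ln X%:R.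
Proof.
move=> k0.
have -> : (rough_count k X)%:R * ln X%:R =
    \sum_(1 <= d < X.+1 | rough k d) ln (X%:R : R).
  by rewrite big_const_seq iter_addr_0 mulr_natl.
apply: (@le_trans _ _ (\sum_(1 <= d < X.+1 | rough k d)
    \sum_(k <= p < X.+1 | (prime p && (p %| d))%N) ln (p%:R : R))); last first.
  rewrite big_nat_cond [leRHS]big_nat_cond; apply: ler_sum => d /andP[/andP[d1 d2] _].
  apply: le_trans (@sum_ln_primes_le R _ d _ d1) _; first exact: iota_uniq.
  by rewrite ler_ln ?posrE ?ltr0n ?ler_nat // (leq_trans d1).
under [leRHS]eq_bigr do rewrite big_mkcondr.
rewrite exchange_big /= big_nat_cond [leRHS]big_nat_cond.
apply: ler_sum => p /andP[/andP[p1 p2] pp].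
rewrite -big_mkcondr /= big_const_seq iter_addr_0 -[leRHS]mulr_natr.
apply: ler_wpM2l; first exact: lnn_ge0.
by rewrite ler_nat rough_count_dvd.
Qed.

Lemma ln2_le1 (R : realType) : ln (2 : R) <= 1.
Proof. by apply: (@le_ln1Dx R 1); lra. Qed.

Lemma ln4_le2 (R : realType) : ln (4 : R) <= 2.
Proof.
have -> : (4 : R) = 2 ^+ 2 by ring.
by rewrite lnXn // -[leRHS]/(1 *+ 2) lerMn2r /= ln2_le1.
Qed.

Lemma mertens_gap (R : realType) m n : (0 < m)%N -> (0 < n)%N ->
  ln n%:R - ln m%:R - 5 <= \sum_(m.+1 <= p < n.+1 | prime p) ln (p%:R : R) / p%:R.
Proof.
move=> m0 n0; have A := mertens_upper R m0; have B := mertens_lower R n0.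
have C := @ln4_le2 R.
have -> : ln n%:R - ln m%:R - 5 = (ln n%:R - 3) - (ln m%:R + 2) :> R by ring.
have [mn|nm] := leqP m n; last first.
  rewrite big_geq; last exact: ltnW.
  have : ln (n%:R : R) <= ln m%:R by rewrite ler_ln ?posrE ?ltr0n ?ler_nat // ltnW.
  lra.
have : mertens_sum R n = mertens_sum R m + \sum_(m.+1 <= p < n.+1 | prime p) ln (p%:R : R) / p%:R.
  by rewrite /mertens_sum (@big_cat_nat _ _ _ m.+1).
lra.
Qed.

(** The density of the [k]-rough numbers is of order [1 / ln k], uniformly in
    [X >= B * k]. The proof is a strong induction on [X] in [rough_count_log], with
    the same constant [c = 1 / (4 * B)] at every step. The primes [p <= X / (B * k)]
    are handled by induction, and by Mertens' estimates they recover the desired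
    bound except for a proportion of about [2 * ln k / ln X]. This deficit is of
    order [c * X / ln X], and it is compensated by the primes between [X / B] and
    [X], each of which contributes at least [ln p] because [1] is rough. *)
Lemma rough_count_lower (R : realType) :
  exists B : nat, (0 < B)%N /\ exists K : nat, forall k X : nat,
    (K <= k)%N -> (B * k <= X)%N ->
    X.+1%:R <= 4 * B%:R * ln (k%:R : R) * (rough_count k X)%:R.
Proof.
have [B [B0 /(_ B (leqnn B)) lB]] := @ln_unbounded R 6.
exists B; split=> //; have [K [_ HK]] := ln_unbounded (ln (B%:R : R) + 6).
exists (maxn 2 K) => k X; rewrite geq_max => /andP[k1 /HK kL].
have k0 : (0 < k)%N by apply: ltnW.
set L := ln (k%:R : R) in kL *.
set c : R := (4 * B%:R)^-1.
have B0' : 1 <= B%:R :> R by rewrite ler1n.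
have c0 : 0 < c by rewrite invr_gt0; lra.
have L0 : 12 <= L by lra.
have [m] := ubnP X; elim: m X => // m IH X lt_Xm BkX.
have X0 : (0 < X)%N by apply: leq_trans BkX; rewrite muln_gt0 B0.
set Y := (X %/ (B * k))%N; set Z := (X %/ B)%N.
have Bk0 : (0 < B * k)%N by rewrite muln_gt0 B0.
have Y0 : (0 < Y)%N by rewrite divn_gt0.
have Zk : (k <= Z)%N by rewrite leq_divRL // mulnC.
have YZ : (Y <= Z)%N by rewrite /Y divnMA leq_div.
have ZX : (Z <= X)%N by apply: leq_div.
have HX := @rough_count_log R k X k0.
have BL : 4 * B%:R * L = L / c by rewrite /c invrK mulrC.
(* Contribution of the primes p <= X / (B * k), to which the induction applies. *)
have S1 : c * X%:R / L * (ln X%:R - ln B%:R - 2 * L - 6) <=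
    \sum_(k <= p < Y.+1 | prime p) ln (p%:R : R) * (rough_count k (X %/ p))%:R.
  have k1' : (0 < k.-1)%N by rewrite -ltnS prednK.
  apply: (@le_trans _ _ (c * X%:R / L * \sum_(k <= p < Y.+1 | prime p) ln (p%:R : R) / p%:R)).
    apply: ler_wpM2l; first by rewrite divr_ge0 ?mulr_ge0 // ?(ltW c0) //; lra.
    have := @mertens_gap R k.-1 Y k1' Y0; rewrite prednK //; apply: le_trans.
    have h1 : ln (k.-1%:R : R) <= L by rewrite ler_ln ?posrE ?ltr0n // ler_nat leq_pred.
    have h2 : ln (X%:R : R) <= ln (Y%:R : R) + (ln B%:R + L) + 1.
      have l2 : ln (2 : R) <= 1 by apply: (@le_ln1Dx R 1); lra.
      apply: (@le_trans _ _ (ln (Y%:R : R) + (ln B%:R + L) + ln 2)); last by lra.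
      rewrite -!lnM ?posrE ?mulr_gt0 ?ltr0n // ler_ln ?posrE ?mulr_gt0 ?ltr0n //.
      rewrite -!natrM ler_nat; have := divn_eq X (B * k); have := ltn_pmod X Bk0.
      by move: Y0; rewrite -/Y; clear; nia.
    lra.
  rewrite mulr_sumr big_nat_cond [leRHS]big_nat_cond; apply: ler_sum => p /andP[/andP[p1 p2] pp].
  rewrite mulrCA; apply: ler_wpM2l; first exact: lnn_ge0.
  have p0 : (0 < p)%N by apply: prime_gt0.
  have p0' : 0 < p%:R :> R by rewrite ltr0n.
  have lt1 : (X %/ p < X)%N by rewrite ltn_Pdiv // prime_gt1.
  have le1 : (B * k <= X %/ p)%N.
    by rewrite leq_divRL // mulnC -leq_divRL.
  have := IH (X %/ p)%N (leq_trans lt1 lt_Xm) le1; rewrite BL.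
  have le2 : X%:R / p%:R <= (X %/ p).+1%:R :> R.
    by rewrite ler_pdivrMr // -natrM ler_nat ltnW // ltn_ceil.
  move=> /(le_trans le2); rewrite mulrAC ler_pdivlMr // => le3.
  have L0' : 0 < L by lra.
  by rewrite mulrAC [c * _]mulrC [_ * c / _]mulrAC ler_pdivrMr // [leRHS]mulrC.
(* Contribution of the primes between X / B and X; ln B >= 6 exceeds the error
   term 5 of the Mertens estimates by 1. *)
have S2 : X%:R / B%:R <=
    \sum_(Z.+1 <= p < X.+1 | prime p) ln (p%:R : R) * (rough_count k (X %/ p))%:R.
  have B0'' : 0 < B%:R :> R by lra.
  have XB0 : 0 <= X%:R / B%:R :> R by rewrite divr_ge0.
  have Z0 : (0 < Z)%N by apply: leq_trans Zk.
  apply: (@le_trans _ _ (X%:R / B%:R * \sum_(Z.+1 <= p < X.+1 | prime p) ln (p%:R : R) / p%:R)).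
    rewrite -[leLHS]mulr1; apply: ler_wpM2l => //.
    apply: le_trans (@mertens_gap R Z X Z0 X0).
    have h : ln (Z%:R : R) + ln B%:R <= ln X%:R.
      rewrite -lnM ?posrE ?ltr0n // ler_ln ?posrE ?mulr_gt0 ?ltr0n //.
      by rewrite -natrM ler_nat leq_trunc_div.
    lra.
  rewrite mulr_sumr big_nat_cond [leRHS]big_nat_cond; apply: ler_sum => p /andP[/andP[p1 p2] pp].
  have p0' : 0 < p%:R :> R by rewrite ltr0n prime_gt0.
  rewrite mulrCA; apply: ler_wpM2l; first exact: lnn_ge0.
  apply: (@le_trans _ _ 1); last first.
    by rewrite ler1n rough_count_gt0 // divn_gt0 ?prime_gt0.
  rewrite ler_pdivrMr // mul1r ler_pdivrMr // -natrM ler_nat.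
  have := ltn_ceil X B0; rewrite -/Z => h; apply: ltnW; apply: leq_trans h _.
  by rewrite leq_mul2r p1 orbT.
have S : \sum_(k <= p < Y.+1 | prime p) ln (p%:R : R) * (rough_count k (X %/ p))%:R +
   \sum_(Z.+1 <= p < X.+1 | prime p) ln (p%:R : R) * (rough_count k (X %/ p))%:R <=
   \sum_(k <= p < X.+1 | prime p) ln (p%:R : R) * (rough_count k (X %/ p))%:R.
  have T0 a b : 0 <= \sum_(a <= p < b | prime p) ln (p%:R : R) * (rough_count k (X %/ p))%:R.
    by apply: sumr_ge0 => p _; rewrite mulr_ge0 ?lnn_ge0.
  rewrite [leRHS](@big_cat_nat _ _ _ Z.+1) /=; [|exact: leqW|by []].
  apply: lerD => //; have [kY|kY] := leqP k Y.+1; last by rewrite big_geq // ltnW.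
  by rewrite [leRHS](@big_cat_nat _ _ _ Y.+1) //= lerDl.
have lX : ln (X%:R : R) <= X%:R by apply/ltW/ln_sublinear; rewrite ltr0n.
have lX0 : L <= ln (X%:R : R).
  by rewrite ler_ln ?posrE ?ltr0n ?ler_nat // (leq_trans Zk).
have {S HX S1 S2} S := le_trans (le_trans (lerD S1 S2) S) HX.
have L0' : 0 < L by lra.
rewrite BL mulrAC ler_pdivlMr // mulrC -(@ler_pM2r _ (ln (X%:R : R))); last by lra.
rewrite -[leRHS]mulrA; apply: le_trans (ler_wpM2l (ltW L0') S).
have cX0 : 0 <= c * X%:R by rewrite mulr_ge0 // ltW.
have -> : X%:R / B%:R = 4 * (c * X%:R) :> R.
  rewrite /c; set b := B%:R; have b0 : b != 0 by rewrite gt_eqF //; lra.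
  by field.
have -> : L * (c * X%:R / L * (ln X%:R - ln B%:R - 2 * L - 6) + 4 * (c * X%:R)) =
   c * X%:R * (ln X%:R - ln B%:R - 2 * L - 6 + 4 * L).
  have L0'' : L != 0 by rewrite gt_eqF.
  by move: L0''; set l := L; move=> ?; field.
rewrite -natr1; have : c * ln X%:R <= c * X%:R by rewrite ler_pM2l.
have : 0 <= c * X%:R * (2 * L - ln B%:R - 7) by apply: mulr_ge0 => //; lra.
lra.
Qed.

(** * The upper bound *)

Local Open Scope nat_scope.

(** A difference [y - x] of two terms of a progression with rough common difference
    determines that common difference. *)
Lemma rough_factor_unique k d d' s s' : rough k d -> rough k d' ->
  0 < s < k -> 0 < s' < k -> s * d = s' * d' -> d = d'.
Proof.
move=> rd rd' sk sk' E; apply/eqP; rewrite eqn_dvd; apply/andP; split.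
  by rewrite -(Gauss_dvdr _ (rough_coprime rd sk')) -E dvdn_mull.
by rewrite -(Gauss_dvdr _ (rough_coprime rd' sk)) E dvdn_mull.
Qed.

Lemma sum_color_counts (t : nat) (chi : nat -> 'I_t) (s : seq nat) :
  \sum_(i < t) count (fun x => chi x == i) s = size s.
Proof.
under eq_bigr do rewrite -sum1_count big_mkcond.
rewrite exchange_big /= -sum1_size; apply: eq_bigr => x _.
by rewrite -big_mkcond /= (big_pred1 (chi x)) // => i; rewrite eq_sym.
Qed.

Lemma equinumerous_count (t n : nat) (chi : nat -> 'I_t) :
  equinumerous (t * n) chi ->
  forall i, count (fun x => chi x == i) (interval1 (t * n)) = n.
Proof.
move=> eqn i; have := sum_color_counts chi (interval1 (t * n)).
rewrite (eq_bigr (fun=> count (fun x => chi x == i) (interval1 (t * n)))) => [|j _]; last exact: eqn.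
rewrite sum_nat_const card_ord size_iota => /eqP.
by rewrite eqn_pmul2l => [/eqP //|]; case: t chi eqn i => // chi _ [].
Qed.

(** If no progression is rainbow, choose in each progression [a, a + d, ...] with
    rough [d <= N / 2k] and [a <= N / 2] two terms [x < y] of one colour, [x] being
    the term of index [i]. By [rough_factor_unique] the triple [(x, y, i)] determines
    [(a, d)]. As [y] lies in the colour class of [x], there are at most
    [N * n * k] such triples, against [N / 2] times the number of rough [d]
    progressions. *)
Lemma forces_of_rough_count k t : 1 < k -> 0 < t ->
  (forall n, 0 < n -> 3 * n * k < rough_count k (t * n %/ (2 * k))) ->
  forces_rainbow_AP k t.
Proof.
move=> k1 t0 many n n0 chi eqn; apply: contrapT => norb.
have cnt := equinumerous_count eqn; have {many} := many n n0.
set N := t * n in eqn norb cnt *; set X := N %/ (2 * k).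
pose RL := [seq d <- index_iota 1 X.+1 | rough k d].
have szRL : size RL = rough_count k X by rewrite size_filter.
pose cls c := [seq x <- interval1 N | chi x == c].
have szcls c : size (cls c) = n by rewrite size_filter cnt.
have N0 : 0 < N by rewrite muln_gt0 t0.
have RLP r : r < rough_count k X ->
    [/\ rough k (nth 0 RL r), 0 < nth 0 RL r & nth 0 RL r <= X].
  rewrite -szRL => /(mem_nth 0); rewrite mem_filter mem_index_iota ltnS.
  by case/andP=> -> /andP[].
(* y is recorded by its rank v.1.2 in the colour class of x = v.1.1 + 1. *)
pose code (u : 'I_(N %/ 2) * 'I_(rough_count k X)) (v : 'I_N * 'I_n * 'I_k) :=
  exists j, [/\ v.2 < j < k, v.1.1.+1 = u.1.+1 + v.2 * nth 0 RL u.2 &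
    nth 0 (cls (chi v.1.1.+1)) v.1.2 = u.1.+1 + j * nth 0 RL u.2].
have codeP u : exists v, code u v.
  case: u => a r; have [rd d0 dX] := RLP r (ltn_ord r); set d := nth 0 RL r in rd d0 dX.
  have inN i : i < k -> 0 < a.+1 + i * d <= N.
    move=> ik; rewrite addSn /=; have aN := ltn_ord a.
    have h1 : i * d <= k.-1 * X by apply: leq_mul => //; lia.
    have h2 : X * (2 * k) <= N by apply: leq_trunc_div.
    have h3 := leq_trunc_div N 2.
    by move: aN h1 h2 h3 k1; clear; nia.
  have /uniqPn : ~~ uniq [seq chi x | x <- arith_prog a.+1 d k].
    apply/negP => un; apply: norb; exists a.+1, d; split => // x /mapP[i].
    rewrite mem_iota add0n => /andP[_ ik] ->; rewrite mem_iota add1n ltnS; exact: inN.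
  move=> /(_ (chi 0))[i [j]]; rewrite !size_map size_iota => -[ij jk].
  rewrite !(nth_map 0) ?size_map ?size_iota //; try by apply: ltn_trans jk.
  rewrite !nth_iota ?add0n //; last by apply: ltn_trans jk.
  have ik := ltn_trans ij jk; have /andP[x0 xN] := inN i ik; have yN := inN j jk => E.
  have xN' : (a.+1 + i * d).-1 < N by lia.
  have ymem : a.+1 + j * d \in cls (chi (a.+1 + i * d)).
    by rewrite mem_filter -E eqxx /= mem_iota add1n ltnS.
  have rn : index (a.+1 + j * d) (cls (chi (a.+1 + i * d))) < n.
    by rewrite -[n in _ < n](szcls (chi (a.+1 + i * d))) index_mem.
  exists (Ordinal xN', Ordinal rn, Ordinal ik), j; split; rewrite /= ?ij ?jk //.
  by rewrite nth_index.
have [f fP] := choice codeP.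
have finj : injective f.
  move=> u u' E; have [j [ijk Ex Ey]] := fP u; have [j' [ijk' Ex' Ey']] := fP u'.
  rewrite -E in ijk' Ex' Ey'; move: (f u) ijk Ex Ey ijk' Ex' Ey' => [[x r] i] /=.
  have [rd d0 dX] := RLP _ (ltn_ord u.2); have [rd' d0' dX'] := RLP _ (ltn_ord u'.2).
  move=> ijk Ex Ey ijk' Ex' Ey'; rewrite Ey in Ey'; rewrite Ex in Ex'.
  have Ed : nth 0 RL u.2 = nth 0 RL u'.2.
    apply: (@rough_factor_unique k _ _ (j - i) (j' - i)) => //.
    - by move: ijk; clear; lia.
    - by move: ijk'; clear; lia.
    - by rewrite !mulnBl -(subnDl u.1.+1) Ey' Ex' subnDl.
  have Er : u.2 = u'.2.
    apply/val_inj/eqP; rewrite -(@nth_uniq _ 0 RL) ?szRL ?ltn_ord ?Ed //.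
    by rewrite filter_uniq ?iota_uniq.
  have Ea : u.1 = u'.1 by apply/val_inj/eqP; move/eqP: Ex'; rewrite Ed eqn_add2r eqSS.
  by move: Ea Er; case: (u) => ? ?; case: (u') => ? ? /= -> ->.
have := leq_card f finj; rewrite !card_prod !card_ord => le1 lt1.
have N2 : 1 < N.
  rewrite ltnNge; apply/negP => N1; move: lt1.
  by rewrite /X divn_small ?ltn0 //; lia.
have N3 : N <= 3 * (N %/ 2) by have := divn_eq N 2; have := ltn_pmod N (isT : 0 < 2); lia.
have N20 : 0 < N %/ 2 by rewrite divn_gt0.
have le2 : N * n * k <= N %/ 2 * (3 * n * k).
  by rewrite !mulnA (mulnC _ 3) -(mulnA N) -(mulnA (3 * _)) leq_mul2r N3 orbT.
have := leq_trans le1 le2; rewrite (leq_pmul2l N20) leqNgt lt1.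
exact: notF.
Qed.

Local Open Scope ring_scope.

Lemma rainbow_upper (R : realType) : exists (C : R) (K : nat), 0 < C /\
  forall k : nat, (K <= k)%N -> exists t : nat,
    [/\ (0 < t)%N, forces_rainbow_AP k t & t%:R <= C * (k%:R ^+ 2 * ln k%:R)].
Proof.
have [B [B0 [K1 HB]]] := rough_count_lower R.
have [K2 [_ HK]] := ln_unbounded (1 : R).
have B1 : 1 <= B%:R :> R by rewrite ler1n.
exists (48 * B%:R), (maxn 2 (maxn K1 K2)); split; first by lra.
move=> k; rewrite !geq_max => /and3P[k1 kK1 /HK L1].
have k0 : 1 <= k%:R :> R by rewrite ler1n ltnW.
have k2 : 1 <= k%:R ^+ 2 :> R by rewrite exprn_ege1.
set L := ln (k%:R : R) in L1 *.
set z : R := 24 * B%:R * (k%:R ^+ 2 * L).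
have kL1 : 1 <= k%:R ^+ 2 * L :> R by rewrite mulr_ege1.
have z1 : 1 <= z by rewrite /z; apply: mulr_ege1 => //; lra.
have z0 : 0 <= z by lra.
have /andP[tz zt] := truncn_itv z0; set t := (Num.truncn z).+1 in zt.
exists t; split => //; last first.
  by rewrite /t -natr1; rewrite /z in tz z1 *; lra.
apply: forces_of_rough_count => // n n0; set X := (t * n %/ (2 * k))%N.
have n1 : 1 <= n%:R :> R by rewrite ler1n.
have zX : z * n%:R < 2 * k%:R * X.+1%:R.
  apply: (@le_lt_trans _ _ (t * n)%N%:R); first by rewrite natrM ler_wpM2r // ltW.
  by rewrite -!natrM ltr_nat [ltnRHS]mulnC ltn_ceil // muln_gt0 (ltnW k1).
have XL : 12 * B%:R * n%:R * k%:R * L < X.+1%:R.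
  rewrite -(@ltr_pM2l _ (2 * k%:R)); last by lra.
  by apply: le_lt_trans zX; rewrite /z le_eqVlt; apply/orP; left; apply/eqP; ring.
have BX : (B * k <= X)%N.
  rewrite -ltnS -(ltr_nat R) natrM; apply: le_lt_trans XL.
  have -> : 12 * B%:R * n%:R * k%:R * L = B%:R * k%:R * (12 * n%:R * L) :> R by ring.
  rewrite ler_peMr ?mulr_ge0 //; do 2 apply: mulr_ege1 => //; lra.
have := HB k X kK1 BX; rewrite -/L => le1.
have := lt_le_trans XL le1.
have -> : 12 * B%:R * n%:R * k%:R * L = 4 * B%:R * L * (3 * n%:R * k%:R) :> R by ring.
rewrite ltr_pM2l; last by rewrite !mulr_gt0 //; lra.
by rewrite -!natrM ltr_nat.
Qed.

(** * Hall's marriage theorem *)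

Local Open Scope nat_scope.

Definition hall_condition (A B : finType) (D : {set A}) (N : A -> {set B}) : Prop :=
  forall S : {set A}, S \subset D -> #|S| <= #|\bigcup_(a in S) N a|.

Definition remove_nbr (A B : finType) (N : A -> {set B}) (a : A) (x : B) : A -> {set B} :=
  fun c => if c == a then N a :\ x else N c.

Lemma not_hallP (A B : finType) (D : {set A}) (N : A -> {set B}) :
  ~ hall_condition D N ->
  exists2 S : {set A}, S \subset D & #|\bigcup_(a in S) N a| < #|S|.
Proof.
by move=> nH; apply: contrapT => H; apply: nH => S SD; rewrite leqNgt;
  apply/negP => lt; apply: H; exists S.
Qed.

(** A violation of Hall's condition caused by removing [x] from [N a] must involve [a].
    The rest [S] of the violating set is so tight that its neighbours, even together
    with the remaining neighbours of [a], are at most [#|S|]. *)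
Lemma remove_nbr_tight (A B : finType) (D : {set A}) (N : A -> {set B}) a x :
  hall_condition D N -> ~ hall_condition D (remove_nbr N a x) ->
  exists S : {set A}, [/\ S \subset D, a \notin S &
    #|\bigcup_(c in S) N c :|: N a :\ x| <= #|S|].
Proof.
move=> H /not_hallP [T TD lt]; have aT : a \in T.
  apply: contraLR lt => aT; rewrite -leqNgt; apply: leq_trans (H T TD) _.
  rewrite subset_leq_card //; apply/bigcupsP => c cT; apply: subset_trans (bigcup_sup c cT).
  by rewrite /remove_nbr ifN //; apply: contraNneq aT => <-.
exists (T :\ a); rewrite !inE eqxx; split => //.
  by apply: subset_trans TD; rewrite subsetDl.
rewrite -ltnS; have -> : #|T :\ a|.+1 = #|T| by rewrite (cardsD1 a T) aT.
apply: leq_ltn_trans lt; rewrite subset_leq_card // subUset; apply/andP; split.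
  apply/bigcupsP => c; rewrite !inE => /andP[ca cT]; apply: subset_trans (bigcup_sup c cT).
  by rewrite /remove_nbr (negbTE ca).
by apply: subset_trans (bigcup_sup a aT); rewrite /remove_nbr eqxx.
Qed.

(** Two tight sets [S] and [T], one for each removal, would contradict Hall's
    condition for [a |: (S :|: T)] and [S :&: T], because the number of neighbours is
    submodular. *)
Lemma hall_remove (A B : finType) (D : {set A}) (N : A -> {set B}) a x y :
  hall_condition D N -> a \in D -> x \in N a -> y \in N a -> x != y ->
  hall_condition D (remove_nbr N a x) \/ hall_condition D (remove_nbr N a y).
Proof.
move=> H aD xa ya xy; apply: contrapT => /not_orP [nx ny].
have [S [SD aS cS]] := remove_nbr_tight H nx.
have [T [TD aT cT]] := remove_nbr_tight H ny.
set X := _ :|: _ in cS; set Y := _ :|: _ in cT.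
have XY : \bigcup_(c in a |: (S :|: T)) N c \subset X :|: Y.
  apply/bigcupsP => c; rewrite !inE => /or3P [/eqP->|cS'|cT'].
  - apply/subsetP => z za; rewrite !inE za !andbT.
    by case: (eqVneq z x) => [->|_]; rewrite ?xy ?orbT.
  - by apply: subset_trans (subsetUl _ _); apply: subset_trans (subsetUl _ _);
      apply: (bigcup_sup c).
  - by apply: subset_trans (subsetUr _ _); apply: subset_trans (subsetUl _ _);
      apply: (bigcup_sup c).
have XI : \bigcup_(c in S :&: T) N c \subset X :&: Y.
  apply/bigcupsP => c; rewrite !inE => /andP[cS' cT']; rewrite subsetI; apply/andP; split.
  - by apply: subset_trans (subsetUl _ _); apply: (bigcup_sup c).
  - by apply: subset_trans (subsetUl _ _); apply: (bigcup_sup c).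
have h1 : #|a |: (S :|: T)| <= #|X :|: Y|.
  apply: leq_trans (subset_leq_card XY); apply: H.
  by rewrite !subUset sub1set aD SD TD.
have h2 : #|S :&: T| <= #|X :&: Y|.
  apply: leq_trans (subset_leq_card XI); apply: H.
  by apply: subset_trans SD; rewrite subsetIl.
move: h1; rewrite cardsU1 !inE (negbTE aS) (negbTE aT) /= => h1.
by move: h1 h2 cS cT (cardsUI X Y) (cardsUI S T); rewrite -/X -/Y; clear; lia.
Qed.

(** Rado's proof: by [hall_remove] the neighbourhoods can be thinned out until they
    are singletons, and then Hall's condition for pairs says that they are
    distinct. *)
Lemma hall_marriage (A B : finType) (b0 : B) (D : {set A}) (N : A -> {set B}) :
  hall_condition D N ->
  exists f : A -> B, {in D &, injective f} /\ {in D, forall a, f a \in N a}.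
Proof.
have [m] := ubnP (\sum_(a in D) #|N a|); elim: m N => // m IH N lt H.
have N0 a : a \in D -> 0 < #|N a|.
  by move=> aD; have := H [set a]; rewrite sub1set aD big_set1 cards1; apply.
have [big|small] := pselect (exists2 a, a \in D & 1 < #|N a|).
  have [a aD /card_gt1P [x [y [xa ya xy]]]] := big.
  have sub z c : remove_nbr N a z c \subset N c.
    by rewrite /remove_nbr; case: eqP => [->|//]; rewrite subsetDl.
  have step z : z \in N a -> hall_condition D (remove_nbr N a z) ->
      exists f : A -> B, {in D &, injective f} /\ {in D, forall a, f a \in N a}.
    move=> za Hz; have [|//|f [fi fN]] := IH (remove_nbr N a z).
      apply: leq_trans (_ : _ < \sum_(a in D) #|N a|) _; last by rewrite -ltnS.
      rewrite (bigD1 a aD) [in leqRHS](bigD1 a aD) /=.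
      rewrite {1}/remove_nbr eqxx (cardsD1 z (N a)) za /= add1n addSn ltnS leq_add2l.
      by apply: leq_sum => c _; apply: subset_leq_card.
    by exists f; split=> // c cD; apply: (subsetP (sub z c)); apply: fN.
  by case: (hall_remove H aD xa ya xy); apply: step.
have N1 a : a \in D -> #|N a| = 1.
  move=> aD; apply/eqP; rewrite eqn_leq N0 // andbT leqNgt; apply/negP => lt1.
  by apply: small; exists a.
exists (fun a => odflt b0 [pick b in N a]); have fP : {in D, forall a, odflt b0 [pick b in N a] \in N a}.
  by move=> a aD; case: pickP => //= no; move: (N0 a aD); rewrite (eq_card0 no).
split=> // a c aD cD E; apply: contrapT => /eqP ac.
have := H [set a; c]; rewrite subUset !sub1set aD cD => /(_ isT).
rewrite bigcup_setU !big_set1 cards2 ac.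
have Ea := fP _ aD; have Ec := fP _ cD; rewrite -E in Ec.
move: Ea Ec; move: (odflt _ _) => z.
have /eqP/cards1P [x ->] := N1 _ aD; have /eqP/cards1P [y ->] := N1 _ cD.
rewrite !inE => /eqP<- /eqP<-.
by rewrite setUid cards1.
Qed.

(** Double counting of the incidences between [S] and its neighbours gives Hall's
    condition. *)
Lemma hall_degree (A B : finType) (b0 : B) (D : {set A}) (N : A -> {set B}) m :
  0 < m -> {in D, forall a, m <= #|N a|} ->
  (forall b, #|[set a in D | b \in N a]| <= m) ->
  exists f : A -> B, {in D &, injective f} /\ {in D, forall a, f a \in N a}.
Proof.
move=> m0 Nm dm; apply: hall_marriage => // S SD.
rewrite -(leq_pmul2l m0); set U := \bigcup_(a in S) N a.
apply: (@leq_trans (\sum_(a in S) #|N a|)).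
  by rewrite mulnC -sum_nat_const; apply: leq_sum => a aS; apply/Nm/(subsetP SD).
have -> : \sum_(a in S) #|N a| = \sum_(b in U) #|[set a in S | b \in N a]|.
  transitivity (\sum_(a in S) \sum_(b in U | b \in N a) 1).
    apply: eq_bigr => a aS; rewrite -sum1_card; apply: eq_bigl => b.
    by case: (boolP (b \in N a)) => ba; rewrite ?andbF // andbT; apply/esym/bigcupP; exists a.
  under eq_bigr do rewrite big_mkcondr.
  rewrite exchange_big /=; apply: eq_bigr => b _; rewrite -big_mkcondr /= -sum1_card.
  by apply: eq_bigl => a; rewrite inE.
rewrite mulnC -sum_nat_const; apply: leq_sum => b _; apply: leq_trans (dm b).
by apply: subset_leq_card; apply/subsetP => a; rewrite !inE => /andP[/(subsetP SD)-> ->].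
Qed.

(** * Counting products of groups of primes *)

Local Open Scope ring_scope.

Lemma sum_subsets_prod (R : realType) (I : finType) (Q : {set I}) (x : I -> R) :
  (forall i, 0 <= x i) ->
  \sum_(T : {set I} | T \subset Q) \prod_(i in T) x i <= expR (\sum_(i in Q) x i).
Proof.
move=> x0; rewrite expR_sum.
have -> : \sum_(T : {set I} | T \subset Q) \prod_(i in T) x i = \prod_(i in Q) (x i + 1).
  pose F i := if i \in Q then x i else 0.
  have -> : \prod_(i in Q) (x i + 1) = \prod_i (F i + 1).
    by rewrite big_mkcond; apply: eq_bigr => i _; rewrite /F; case: ifP; rewrite ?add0r.
  rewrite bigA_distr /= big_mkcond; apply: eq_bigr => T _.
  rewrite -big_mkcond /=; case: ifPn => [TQ|].
    by apply: eq_bigr => i iT; rewrite /F (subsetP TQ).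
  case/subsetPn => i iT iQ; rewrite (bigD1 i iT) /= /F (negbTE iQ) mul0r //.
by apply: ler_prod => i _; rewrite addr_ge0 // addrC expR_ge1Dx.
Qed.

(** Let [W] be the sum of [2 ^+ #|S|] over the sets [S] with [\prod v <= Y]. Writing
    [ln Y] as [ln (Y / \prod v)] plus the sum of [ln (v g)] over [g] in [S], one finds
    that [W * ln Y] is at most [Y * (1 + 2 * C)] times the sum of
    [2 ^+ #|S| / \prod v] over all [S]: the first part is bounded by
    [Y / \prod v], and in the second one removes [g] from [S] and sums over [g] by
    hypothesis. This is the classical bound for the number of integers up to [Y]
    composed of given primes; the weight [2 ^+ #|S|] makes large sets rare. *)
Lemma count_large_sets (R : realType) (I : finType) (v : I -> nat) (Q : {set I})
    (C : R) (Y r : nat) :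
  (forall g, 0 < v g)%N ->
  (forall y : nat, \sum_(g in Q | (v g <= y)%N) ln ((v g)%:R : R) <= C * y%:R) ->
  0 <= C -> (0 < Y)%N ->
  #|[set S : {set I} | [&& S \subset Q, \prod_(g in S) v g <= Y & r <= #|S| ]%N]|%:R
    * 2 ^+ r * ln Y%:R
  <= Y%:R * (1 + 2 * C) * expR (\sum_(g in Q) 2 / (v g)%:R).
Proof.
move=> v0 vC C0 Y0.
have Y0' : 0 < Y%:R :> R by rewrite ltr0n.
pose ok (S : {set I}) := (S \subset Q) && (\prod_(g in S) v g <= Y)%N.
pose P (S : {set I}) : R := \prod_(g in S) (v g)%:R.
have P0 S : 0 < P S by apply: prodr_gt0 => g _; rewrite ltr0n.
have PE S : P S = (\prod_(g in S) v g)%N%:R by rewrite natr_prod.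
pose w (S : {set I}) : R := 2 ^+ #|S|.
have w0 S : 0 < w S by rewrite exprn_gt0.
have wP S : w S / P S = \prod_(g in S) (2 / (v g)%:R).
  by rewrite /w -prodr_const -prodfV -big_split.
set E := expR _.
have sumE : \sum_(S : {set I} | S \subset Q) w S / P S <= E.
  under eq_bigr do rewrite wP.
  by apply: sum_subsets_prod => i; rewrite divr_ge0.
apply: (@le_trans _ _ (\sum_(S | ok S) w S * ln Y%:R)).
  rewrite -mulr_suml; apply: ler_wpM2r; first exact: lnn_ge0.
  rewrite -sum1_card natr_sum mulr_suml big_mkcond [leRHS]big_mkcond /=.
  apply: ler_sum => S _; rewrite inE /ok; case: ifP => [/and3P[-> -> rS]|_].
    by rewrite mul1r ler_weXn2l // ler1n.
  by case: ifP => // _; apply: ltW.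
have split S : ok S -> w S * ln Y%:R <= Y%:R * (w S / P S) + \sum_(g in S) w S * ln (v g)%:R.
  case/andP=> _ SY; rewrite -mulr_sumr mulrCA -mulrDr; apply: ler_wpM2l; first exact: ltW.
  have -> : \sum_(g in S) ln ((v g)%:R : R) = ln (P S) by rewrite PE ln_prodn.
  rewrite -lerBlDr -ln_div ?posrE //.
  by apply/ltW/ln_sublinear/divr_gt0.
apply: (le_trans (ler_sum _ split)); rewrite big_split /=.
have T1 : \sum_(S | ok S) Y%:R * (w S / P S) <= Y%:R * E.
  rewrite -mulr_sumr; apply: ler_wpM2l => //; apply: le_trans sumE.
  rewrite big_mkcond [leRHS]big_mkcond; apply: ler_sum => S _; rewrite /ok.
  case: ifP => [/andP[-> _] //|_]; case: ifP => // _; apply: divr_ge0; exact: ltW.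
(* The substitution S = g |: T. *)
have T2 : \sum_(S | ok S) \sum_(g in S) w S * ln (v g)%:R <= 2 * C * Y%:R * E.
  pose p (S : {set I}) := (\prod_(g in S) v g)%N.
  have p0 S : (0 < p S)%N by apply: prodn_gt0.
  under eq_bigr do rewrite big_mkcond.
  rewrite exchange_big /=.
  apply: (@le_trans _ _ (\sum_g \sum_(T : {set I} | T \subset Q)
      if (g \in Q) && (v g <= Y %/ p T)%N then 2 * w T * ln (v g)%:R else 0)).
    apply: ler_sum => g _; rewrite -big_mkcondr /=.
    rewrite (reindex_onto (fun T => g |: T) (fun S => S :\ g)) /=; last first.
      by move=> S /andP[_ gS]; rewrite setD1K.
    rewrite big_mkcond [leRHS]big_mkcond; apply: ler_sum => T _.
    case: ifP => [/andP[/andP[okS _] /eqP TE]|_]; last first.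
      case: ifP => // _; case: ifP => // _.
      by rewrite !mulr_ge0 ?lnn_ge0 // ltW.
    have gT : g \notin T by rewrite -TE !inE eqxx.
    move: okS; rewrite /ok subUset sub1set => /andP[/andP[-> ->]] /=.
    rewrite big_setU1 //= -/(p T) => le; rewrite leq_divRL // le.
    by rewrite /w cardsU1 gT exprS.
  rewrite exchange_big /=.
  apply: (@le_trans _ _ (\sum_(T : {set I} | T \subset Q) 2 * C * Y%:R * (w T / P T))); last first.
    by rewrite -mulr_sumr mulrC [leRHS]mulrC; apply: ler_wpM2r => //; rewrite !mulr_ge0.
  apply: ler_sum => T _; rewrite -big_mkcond /= -mulr_sumr.
  have PT := P0 T.
  have le1 : (Y %/ p T)%N%:R <= Y%:R / P T :> R.
    by rewrite ler_pdivlMr // PE -natrM ler_nat leq_trunc_div.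
  have -> : 2 * C * Y%:R * (w T / P T) = 2 * w T * (C * (Y%:R / P T)).
    by move: (P T)^-1 => q; ring.
  apply: ler_wpM2l; first by rewrite mulr_ge0 // ltW.
  by apply: le_trans (vC _) _; apply: ler_wpM2l.
rewrite mulrDr mulr1 mulrDl; apply: lerD T1 _.
by rewrite [Y%:R * _]mulrC.
Qed.

(** * Groups of primes *)

Local Open Scope nat_scope.

Definition block (p : nat) : nat := trunc_log 2 p.

Definition block_rank (p : nat) : nat :=
  count (fun q => prime q && (block q == block p)) (iota 0 p).

Lemma block_bounds p : 0 < p -> 2 ^ block p <= p < 2 ^ (block p).+1.
Proof. by move=> p0; apply: trunc_log_bounds. Qed.

Lemma block_le p : block p <= p.
Proof.
case: p => // p; have /andP[h _] := @block_bounds p.+1 isT.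
by apply: ltnW; apply: leq_trans h; apply: ltn_expl.
Qed.

Lemma block_rank_le p : block_rank p <= p.
Proof. by rewrite /block_rank (leq_trans (count_size _ _)) ?size_iota. Qed.

Lemma block_rank_lt p q : prime p -> p < q -> block p = block q ->
  block_rank p < block_rank q.
Proof.
move=> pp pq E; have Eq : iota 0 q = iota 0 p ++ iota p (q - p) by rewrite -iotaD subnKC // ltnW.
rewrite /block_rank -E Eq count_cat.
have -> : q - p = (q - p.+1).+1 by rewrite subnSK.
by rewrite /= pp eqxx addnA addn1 ltnS leq_addr.
Qed.

Lemma block_rank_inj p q : prime p -> prime q -> block p = block q ->
  block_rank p = block_rank q -> p = q.
Proof.
move=> pp pq E R; case: (ltngtP p q) => // lt.
  by have := block_rank_lt pp lt E; rewrite R ltnn.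
by have := block_rank_lt pq lt (esym E); rewrite R ltnn.
Qed.

(** The primes of a block are factors of the primorial of [2 ^ b.+1]. *)
Lemma block_count M b :
  b * count (fun q => prime q && (block q == b)) (iota 0 M) <= 2 ^ b.+2.
Proof.
rewrite -size_filter; set s := seq.filter _ _.
have sP q : q \in s -> prime q /\ 2 ^ b <= q < 2 ^ b.+1.
  rewrite mem_filter => /andP[/andP[pq /eqP <-] _]; split=> //.
  by rewrite block_bounds ?prime_gt0.
rewrite -(leq_exp2l (m := 2)) // expnM.
have -> : 2 ^ 2 ^ b.+2 = 4 ^ 2 ^ b.+1 by rewrite [in LHS]expnS expnM.
apply: leq_trans (primorial_le _).
apply: (@leq_trans (\prod_(q <- s) q)).
  rewrite -[size s]count_predT -sum1_count expn_sum /= !big_seq.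
  by apply: leq_prod => q /sP [_ /andP[]].
apply: dvdn_leq; first by apply: prodn_cond_gt0 => p /prime_gt0.
apply: prod_primes_dvdn; first by rewrite filter_uniq ?iota_uniq.
move=> q /sP[pq /andP[_ q2]]; split=> //.
by rewrite (big_rem q) ?mem_index_iota ?prime_gt0 //= ?pq ?dvdn_mulr // ltnS ltnW.
Qed.

(** At level [i] the primes of block [b] are cut into groups of [2 ^ group_exp l b i]
    consecutive primes: as many as possible, but at least one, for [2 ^ i] groups to have
    a product of at most [2 ^ (l / 4)]. *)
Definition group_exp (l b i : nat) : nat := trunc_log 2 (l %/ (8 * b)) - i.

(** Completing a prime of block [b] to its whole group multiplies it by at most
    [2 ^ (b.+1 * (2 ^ group_exp l b i).-1)]; [2 ^ i] such factors have a product of at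
    most [2 ^ (l %/ 4)]. *)
Lemma group_exp_budget l b i :
  2 ^ i * (b.+1 * (2 ^ group_exp l b i).-1) <= l %/ 4.
Proof.
rewrite /group_exp; set e := trunc_log _ _.
have [ei|ie] := leqP e i; first by rewrite (eqP (_ : e - i == 0)) ?subn_eq0 // !muln0.
have q0 : 0 < l %/ (8 * b).
  by case: posnP ie => // E; rewrite /e E trunc_log0.
have b0 : 0 < b by case: b q0 {e ie} => //; rewrite muln0 divn0.
have := trunc_logP (isT : 1 < 2) q0; rewrite -/e -{1}(subnKC (ltnW ie)) expnD => le.
rewrite leq_divRL //.
have : 2 ^ i * 2 ^ (e - i) * (8 * b) <= l by rewrite -leq_divRL // muln_gt0.
have := leq_pred (2 ^ (e - i)); move: b0; move: (2 ^ (e - i)) (2 ^ i) => x y; move: (x.-1) => z.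
clear; move=> b0 zx; apply: leq_trans.
rewrite -!mulnA leq_mul2l; apply/orP; right.
apply: (@leq_trans (2 * b * x * 4)); last by lia.
by rewrite mulnA leq_mul2r /= leq_mul //; lia.
Qed.

(** Up to constants, a group has the largest size that the budget allows. *)
Lemma group_exp_lower l b i : 0 < b -> l < 16 * b * 2 ^ i * 2 ^ group_exp l b i.
Proof.
move=> b0; rewrite /group_exp; set e := trunc_log _ _.
have h := @trunc_log_ltn 2 (l %/ (8 * b)) isT; rewrite -/e in h.
have h8 : 0 < 8 * b by rewrite muln_gt0.
have : l < 2 ^ e.+1 * (8 * b) by rewrite -ltn_divLR.
move/leq_trans; apply; rewrite expnS -[in leqRHS]mulnA -expnD.
have : 2 ^ e <= 2 ^ (i + (e - i)) by rewrite leq_exp2l // -leq_subLR.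
move: (2 ^ e) (2 ^ (i + _)) => x y xy; have -> : 2 * x * (8 * b) = 16 * b * x by lia.
by rewrite leq_mul2l xy orbT.
Qed.

Local Open Scope nat_scope.

(** A group of primes is labelled by its block and its position in the block. *)
Definition group_key (X l i : nat) (p : 'I_X.+1) : 'I_X.+1 * 'I_X.+1 :=
  (inord (block p), inord (block_rank p %/ 2 ^ group_exp l (block p) i)).

Definition prime_divisors (X u : nat) : {set 'I_X.+1} :=
  [set p : 'I_X.+1 | prime p && (p %| u)].

Definition hit_groups (X l i u : nat) : {set 'I_X.+1 * 'I_X.+1} :=
  group_key l i @: prime_divisors X u.

Definition group_prod (X l i : nat) (S : {set 'I_X.+1 * 'I_X.+1}) : nat :=
  \prod_(p : 'I_X.+1 | prime p && (group_key l i p \in S)) p.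

Definition squarefree (u : nat) : Prop := forall p, prime p -> logn p u <= 1.

Lemma group_keyP (X l i : nat) (p : 'I_X.+1) (g : 'I_X.+1 * 'I_X.+1) :
  group_key l i p = g <->
  block p = g.1 /\ block_rank p %/ 2 ^ group_exp l g.1 i = g.2.
Proof.
have pX := ltn_ord p.
have h1 : block p < X.+1 by apply: leq_ltn_trans (block_le p) pX.
have h2 e : block_rank p %/ 2 ^ e < X.+1.
  by apply: leq_ltn_trans (leq_div _ _) _; apply: leq_ltn_trans (block_rank_le p) pX.
split=> [<-|]; first by rewrite /= !inordK.
case: g => a b /= [E1 E2]; rewrite /group_key E1 E2.
by congr (_, _); apply: val_inj; rewrite /= inordK.
Qed.

Lemma group_size (X l i : nat) (g : 'I_X.+1 * 'I_X.+1) :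
  #|[set p : 'I_X.+1 | prime p & group_key l i p == g]| <= 2 ^ group_exp l g.1 i.
Proof.
set e := group_exp _ _ _; set D := [set p | _ & _].
have f0 (p : 'I_X.+1) : block_rank p %% 2 ^ e < 2 ^ e by rewrite ltn_pmod ?expn_gt0.
rewrite -[leqRHS]card_ord -(@card_in_imset _ _ (fun p => Ordinal (f0 p)) (mem D)).
  exact: max_card.
move=> p q; rewrite !inE => /andP[pp /eqP/group_keyP[b1 r1]] /andP[pq /eqP/group_keyP[b2 r2]].
move=> /(congr1 val) /= Em; apply/val_inj/block_rank_inj => //; first by rewrite b1 b2.
by rewrite (divn_eq (block_rank p) (2 ^ e)) r1 Em -r2 -divn_eq.
Qed.

(** The groups of level [i.+1] refine those of level [i]. *)
Lemma card_hit_groups_mono (X l i u : nat) :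
  #|hit_groups X l i u| <= #|hit_groups X l i.+1 u|.
Proof.
pose f (g : 'I_X.+1 * 'I_X.+1) : 'I_X.+1 * 'I_X.+1 :=
  (g.1, inord (g.2 %/ 2 ^ (group_exp l g.1 i - group_exp l g.1 i.+1))).
apply: leq_trans (leq_imset_card f _); apply: subset_leq_card.
apply/subsetP => g /imsetP[p pu ->]; apply/imsetP; exists (group_key l i.+1 p).
  exact: imset_f.
have /group_keyP[b1 r1] := erefl (group_key l i.+1 p).
apply/group_keyP; rewrite /f; move: (group_key l i.+1 p) b1 r1 => [b m] /= b1 r1.
split=> //; rewrite -r1 -divnMA -expnD subnKC; last by rewrite /group_exp leq_sub2l.
rewrite inordK //; apply: leq_ltn_trans (leq_div _ _) _.
exact: leq_ltn_trans (block_rank_le p) (ltn_ord p).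
Qed.

Lemma squarefree_prod (X u : nat) : squarefree u -> 0 < u <= X ->
  u = \prod_(p in prime_divisors X u) p.
Proof.
move=> sq /andP[u0 uX].
rewrite -{1}(partnT u0) (widen_partn predT uX) big_mkord [RHS]big_mkcond /=.
apply: eq_big => [p|p _]; first by [].
rewrite inE; case: (boolP (prime p)) => pp /=; last by rewrite lognE (negbTE pp).
have := sq p pp; case: (boolP (p %| u)) => pu; last first.
  by rewrite lognE (negbTE pu) !andbF.
have : 0 < logn p u by rewrite logn_gt0 mem_primes pp u0.
by case: (logn p u) => [|[|n]] //; rewrite expn1.
Qed.

Lemma hit_groups_weight (X l i u : nat) : squarefree u -> 0 < u <= X ->
  \prod_(g in hit_groups X l i u) 2 ^ g.1 <= u.
Proof.
move=> sq uX; rewrite [leqRHS](squarefree_prod sq uX).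
rewrite (partition_big_imset (group_key l i)) /=; apply: leq_prod => g.
case/imsetP => p pu Eg; rewrite (bigD1 p) /=; last by rewrite pu Eg eqxx.
have /andP[pp _] : prime p && (p %| u) by move: pu; rewrite inE.
apply: (@leq_trans p); last first.
  rewrite leq_pmulr // prodn_cond_gt0 // => q; rewrite inE.
  by case/andP => /andP[/andP[/prime_gt0]].
have /esym/group_keyP[<- _] := Eg.
by have /andP[] := block_bounds (prime_gt0 pp).
Qed.

Lemma group_prod_split (X l i u : nat) : squarefree u -> 0 < u <= X ->
  group_prod l i (hit_groups X l i u) = u *
    \prod_(p : 'I_X.+1 | (prime p && (group_key l i p \in hit_groups X l i u)) && ~~ (p %| u)) p.
Proof.
move=> sq uX; rewrite /group_prod (bigID (fun p : 'I_X.+1 => p %| u)) /=; congr (_ * _).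
rewrite [RHS](squarefree_prod sq uX); apply: eq_bigl => p; rewrite inE.
case: (boolP (prime p)) => //= pp; case: (boolP (p %| u)) => pu; rewrite ?andbF ?andbT //.
by apply: imset_f; rewrite inE pp.
Qed.

(** In each of the at most [2 ^ i] groups that it hits, [u] already contains one
    prime, and the others are paid for by [group_exp_budget]. *)
Lemma group_prod_le (X l i u : nat) : squarefree u -> 0 < u <= X ->
  #|hit_groups X l i u| <= 2 ^ i ->
  group_prod l i (hit_groups X l i u) <= u * 2 ^ (l %/ 4).
Proof.
move=> sq uX few; rewrite group_prod_split // leq_mul2l; apply/orP; right.
set S := hit_groups _ _ _ _ in few *.
apply: (@leq_trans (2 ^ \sum_(p : 'I_X.+1 | (prime p && (group_key l i p \in S)) && ~~ (p %| u)) (block p).+1)).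
  rewrite expn_sum; apply: leq_prod => p /andP[/andP[pp _] _].
  by have /andP[_ /ltnW] := block_bounds (prime_gt0 pp).
rewrite leq_exp2l // -(leq_pmul2l (expn_gt0 2 i)).
apply: leq_trans (leq_mul few (leqnn _)).
rewrite (partition_big (group_key l i) (mem S)) /=; last by move=> p /andP[/andP[]].
rewrite big_distrr /= -sum_nat_const; apply: leq_sum => g gS.
apply: leq_trans (group_exp_budget l g.1 i); rewrite leq_mul2l; apply/orP; right.
rewrite (eq_bigr (fun=> g.1.+1)); last first.
  by move=> p /andP[_ /eqP/group_keyP[-> _]].
rewrite sum_nat_const mulnC leq_mul2l; apply/orP; right.
rewrite -ltnS prednK ?expn_gt0 //; apply: leq_trans (group_size l i g).
have /imsetP[p pu Eg] := gS; apply: proper_card; apply/properP; split.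
  by apply/subsetP => q; rewrite !inE => /andP[/andP[/andP[-> _] _] ->].
exists p; move: pu; rewrite !inE => /andP[pp pu]; first by rewrite pp Eg eqxx.
by rewrite unfold_in pu !andbF.
Qed.

Local Open Scope nat_scope.

Definition prime_groups (X l i : nat) : {set 'I_X.+1 * 'I_X.+1} :=
  group_key l i @: [set p : 'I_X.+1 | prime p].

Lemma hit_groups_sub (X l i u : nat) : hit_groups X l i u \subset prime_groups X l i.
Proof. by apply: imsetS; apply/subsetP => p; rewrite !inE => /andP[]. Qed.

Definition groups_in_block (X l i b : nat) : nat :=
  #|[set g in prime_groups X l i | g.1 == b :> nat]|.

Definition primes_in_block (X b : nat) : nat :=
  count (fun q => prime q && (block q == b)) (iota 0 X.+1).

Lemma groups_in_block_le (X l i b : nat) :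
  groups_in_block X l i b <= primes_in_block X b %/ 2 ^ group_exp l b i + 1.
Proof.
rewrite /groups_in_block addn1; set d := _ %/ _; set G := [set _ in _ | _].
have GP g : g \in G -> g.1 = b :> nat /\ g.2 < d.+1.
  rewrite inE => /andP[/imsetP[p pp /esym/group_keyP[E1 E2]] /eqP E].
  split=> //; rewrite -E2 -E1 ltnS E1 E leq_div2r // /block_rank E1 E.
  have E0 : iota 0 X.+1 = iota 0 p ++ iota p (X.+1 - p).
    by rewrite -iotaD subnKC // ltnW.
  by rewrite /primes_in_block E0 count_cat leq_addr.
pose f (g : 'I_X.+1 * 'I_X.+1) : 'I_d.+1 := inord g.2.
rewrite -[leqRHS]card_ord -(@card_in_imset _ _ f (mem G)); first exact: max_card.
move=> g h /GP[g1 g2] /GP[h1 h2] /(congr1 val); rewrite /f /= !inordK // => E.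
case: g h g1 g2 h1 h2 E => [a c] [a' c'] /= Ea _ Ea' _ Ec.
by congr (_, _); apply: val_inj => //=; rewrite Ea Ea'.
Qed.

Lemma groups_in_block_eq0 (X l i b n : nat) : X < 2 ^ n ->
  ~~ (1 <= b < n) -> groups_in_block X l i b = 0.
Proof.
move=> Xn nb; apply: eq_card0 => g; apply/negbTE; rewrite inE; apply/negP.
move=> /andP[/imsetP[p pp /esym/group_keyP[E1 _]] /eqP E].
move: pp; rewrite inE => pp; apply: (negP nb); rewrite -E -E1.
have /andP[h _] := block_bounds (prime_gt0 pp).
rewrite trunc_log_max ?prime_gt1 //= -(ltn_exp2l (m := 2)) //.
by apply: leq_ltn_trans h _; apply: leq_ltn_trans Xn; rewrite -ltnS ltn_ord.
Qed.

Local Open Scope ring_scope.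

Lemma sum_imset_le (R : realType) (I J : finType) (f : I -> J) (D : {set I})
    (F : J -> R) : (forall j, 0 <= F j) ->
  \sum_(j in f @: D) F j <= \sum_(i in D) F (f i).
Proof.
move=> F0; rewrite [leRHS](partition_big_imset f) /=; apply: ler_sum => j.
case/imsetP => i iD ->; rewrite (bigD1 i) /=; last by rewrite iD eqxx.
by rewrite lerDl sumr_ge0.
Qed.

(** Each group contains a prime, so Chebyshev's bound for [theta] applies. *)
Lemma groups_log_sum (R : realType) (X l i y : nat) :
  \sum_(g in prime_groups X l i | (2 ^ g.1 <= y)%N) ln ((2 ^ g.1)%N%:R : R) <= 4 * y%:R.
Proof.
rewrite big_mkcondr /=.
apply: le_trans (sum_imset_le _ _ _) _.
  by move=> g; case: ifP => // _; apply: lnn_ge0.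
apply: (@le_trans _ _ (theta R (2 * y))); last first.
  apply: le_trans (theta_le _ _) _; rewrite natrM.
  have l4 : ln (4 : R) <= 2 by exact: ln4_le2.
  have := ler_wpM2l (ler0n R y) l4; lra.
apply: (@le_trans _ _ (\sum_(0 <= p < X.+1 | prime p && (p < (2 * y).+1)%N) ln (p%:R : R))).
  rewrite big_mkord big_mkcond [leRHS]big_mkcond; apply: ler_sum => p _.
  rewrite inE; case: (boolP (prime p)) => //= pp.
  have /group_keyP[<- _] := erefl (group_key l i p).
  have /andP[h1 h2] := block_bounds (prime_gt0 pp).
  case: ifP => [le|_]; last by case: ifP => // _; apply: lnn_ge0.
  rewrite ifT; last by rewrite ltnS; apply/ltnW/(leq_trans h2); rewrite expnS leq_mul2l le orbT.
  by rewrite ler_ln ?posrE ?ltr0n ?expn_gt0 ?prime_gt0 // ler_nat.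
have Wid n m : (n <= m)%N -> \sum_(0 <= p < n | prime p && (p < (2 * y).+1)%N) ln (p%:R : R) <=
   \sum_(0 <= p < m | prime p && (p < (2 * y).+1)%N) ln (p%:R : R).
  by move=> nm; rewrite [leRHS](@big_cat_nat _ _ _ n) //= lerDl; apply: sumr_ge0 => p _; exact: lnn_ge0.
apply: le_trans (Wid _ (maxn X.+1 (2 * y).+1) (leq_maxl _ _)) _.
rewrite -(big_nat_widen 0 (2 * y).+1 (maxn X.+1 (2 * y).+1)); last exact: leq_maxr.
by rewrite /theta big_ltn_cond //=.
Qed.

Lemma sum_inv_pow2 (R : realType) n : \sum_(1 <= b < n.+1) (2 : R) / 2 ^+ b <= 2.
Proof.
suff -> : \sum_(1 <= b < n.+1) (2 : R) / 2 ^+ b = 2 - 2 / 2 ^+ n.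
  by rewrite gerBl divr_ge0 // exprn_ge0.
elim: n => [|n IH]; first by rewrite big_geq // expr0 divr1 subrr.
rewrite big_nat_recr //= IH exprS; have h : (2 : R) ^+ n != 0 by rewrite expf_eq0 pnatr_eq0 andbF.
by move: h; set x := 2 ^+ n => h; field.
Qed.

(** Block [b] contains at most [4 * 2 ^ b / b] primes, hence about
    [4 * 2 ^ b / (b * 2 ^ group_exp l b i)] groups, and contributes the corresponding
    multiple of [1 / (b * 2 ^ group_exp l b i)]. This is at most [16 * 2 ^ i / l] by
    the choice of the group size and at most [1 / b]. Using the first bound for
    [b <= l / 1024] and the second one for the other blocks, the total is a
    multiple of [2 ^ i] that is small enough for [level_decay], plus a constant. *)
Lemma groups_inv_sum (R : realType) (X l i : nat) :
  (1024 <= l)%N -> (X < 2 ^ (4 * l).+1)%N ->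
  \sum_(g in prime_groups X l i) (2 : R) / (2 ^ g.1)%N%:R <= 2 ^+ i / 8 + (2 + 32 * 1024).
Proof.
move=> l1 XL; pose m := (l %/ 1024)%N.
have m0 : (0 < m)%N by rewrite divn_gt0.
have l0 : 0 < l%:R :> R by rewrite ltr0n; apply: leq_trans l1.
pose F b : R := (groups_in_block X l i b)%:R * (2 / 2 ^+ b).
have -> : \sum_(g in prime_groups X l i) (2 : R) / (2 ^ g.1)%N%:R = \sum_(0 <= b < X.+1) F b.
  rewrite big_mkord (partition_big (fun g : 'I_X.+1 * 'I_X.+1 => g.1) predT) //=.
  apply: eq_bigr => b _; rewrite /F /groups_in_block -sum1_card natr_sum mulr_suml.
  apply: eq_big => [g|g /andP[_ /eqP->]]; first by rewrite inE.
  by rewrite mul1r natrX.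
pose G b : R := 2 / 2 ^+ b + ((b <= m)%N%:R * (128 * 2 ^+ i / l%:R) + 8 / m.+1%:R).
have FG b : (1 <= b)%N -> F b <= G b.
  move=> b1; rewrite /F /G; set e := group_exp l b i.
  have b0 : 0 < b%:R :> R by rewrite ltr0n.
  have e0 : 1 <= 2 ^+ e :> R by rewrite exprn_ege1 // ler1n.
  have pb0 : 0 < 2 ^+ b :> R by rewrite exprn_gt0.
  have be0 : 0 < b%:R * 2 ^+ e :> R by rewrite mulr_gt0 // (lt_le_trans ltr01).
  have D1 : (groups_in_block X l i b)%:R <= (primes_in_block X b)%:R / 2 ^+ e + 1 :> R.
    apply: (@le_trans _ _ ((primes_in_block X b %/ 2 ^ e + 1)%N%:R)).
      by rewrite ler_nat groups_in_block_le.
    rewrite natrD lerD2r ler_pdivlMr ?(lt_le_trans ltr01) //.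
    by rewrite -natrX -natrM ler_nat leq_trunc_div.
  have D2 : (primes_in_block X b)%:R <= 4 * 2 ^+ b / b%:R :> R.
    rewrite ler_pdivlMr // mulrC; have := block_count X.+1 b.
    have E4 : 2 ^+ b.+2 = 4 * 2 ^+ b :> R by rewrite !exprS; ring.
    by rewrite -(ler_nat R) natrM natrX E4.
  have D3 : 8 / (b%:R * 2 ^+ e) <= (b <= m)%N%:R * (128 * 2 ^+ i / l%:R) + 8 / m.+1%:R :> R.
    have [bm|mb] := leqP b m.
      rewrite mul1r; apply: ler_wpDr; first by rewrite divr_ge0.
      rewrite ler_pdivrMr // mulrAC ler_pdivlMr //.
      have := group_exp_lower l i b1; rewrite -/e => /ltnW.
      rewrite -(ler_nat R) !natrM !natrX; lra.
    rewrite mul0r add0r; apply: ler_wpM2l => //; rewrite lef_pV2 ?posrE ?ltr0n //.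
    by apply: (@le_trans _ _ b%:R); [rewrite ler_nat | rewrite ler_peMr // ltW].
  have : (groups_in_block X l i b)%:R * (2 / 2 ^+ b) <=
      (4 * 2 ^+ b / b%:R / 2 ^+ e + 1) * (2 / 2 ^+ b) :> R.
    apply: ler_wpM2r; first by rewrite divr_ge0 // ltW.
    apply: le_trans D1 _; rewrite lerD2r; apply: ler_wpM2r D2.
    by rewrite invr_ge0 (le_trans ler01).
  move/le_trans; apply; rewrite mulrDl mul1r addrC lerD2l.
  apply: le_trans D3; rewrite le_eqVlt; apply/orP; left; apply/eqP.
  move: pb0 b0 e0; set x := 2 ^+ b; set y := b%:R; set z := 2 ^+ e => x0 y0 z1.
  have hx : x != 0 by rewrite gt_eqF.
  have hy : y != 0 by rewrite gt_eqF.
  have hz : z != 0 by rewrite gt_eqF //; lra.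
  by field; rewrite hx hy hz.
apply: (@le_trans _ _ (\sum_(1 <= b < (4 * l).+1) F b)).
  have F0 b : ~~ (1 <= b < (4 * l).+1)%N -> F b = 0.
    by move=> h; rewrite /F (groups_in_block_eq0 _ _ XL h) mul0r.
  have Fge b : 0 <= F b by rewrite mulr_ge0 ?divr_ge0 ?exprn_ge0.
  pose M := maxn X.+1 (4 * l).+1.
  apply: (@le_trans _ _ (\sum_(0 <= b < M) F b)).
    by rewrite [leRHS](@big_cat_nat _ _ _ X.+1) ?leq_maxl //= lerDl sumr_ge0.
  rewrite (@big_cat_nat _ _ _ (4 * l).+1) ?leq_maxr //= big_ltn // F0 // add0r.
  rewrite [X in _ + X]big_nat_cond [X in _ + X]big1 ?addr0 //.
  move=> b /andP[/andP[h _] _]; apply: F0.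
  by rewrite ltnS (leqNgt b) h andbF.
apply: (@le_trans _ _ (\sum_(1 <= b < (4 * l).+1) G b)).
  by rewrite big_nat_cond [leRHS]big_nat_cond; apply: ler_sum => b /andP[/andP[b1 _] _]; apply: FG.
rewrite /G big_split big_split /= sumr_const_nat subSS subn0.
have S1 := sum_inv_pow2 R (4 * l).
have S2 : \sum_(1 <= b < (4 * l).+1) (b <= m)%N%:R <= m%:R :> R.
  rewrite -natr_sum ler_nat; suff H n : (\sum_(1 <= b < n.+1) (b <= m) <= minn n m)%N.
    by apply: leq_trans (H _) _; rewrite geq_minr.
  elim: n => [|n IH]; first by rewrite big_geq.
  by rewrite big_nat_recr //=; move: IH; set s := (\sum_(_ <= _ < _) _)%N; clear; lia.
have S3 : m%:R * (128 * 2 ^+ i / l%:R) <= 2 ^+ i / 8 :> R.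
  have h : m%:R * 1024 <= l%:R :> R by rewrite -natrM ler_nat leq_trunc_div.
  rewrite mulrA ler_pdivrMr //; have : 0 <= 2 ^+ i :> R by rewrite exprn_ge0.
  move: (2 ^+ i) => x x0; have := ler_wpM2l x0 h; lra.
have S4 : 8 / m.+1%:R *+ (4 * l) <= 32 * 1024 :> R.
  rewrite -mulr_natr mulrAC ler_pdivrMr ?ltr0n // -!natrM ler_nat.
  by have := ltn_ceil l (isT : 0 < 1024)%N; rewrite -/m; clear; lia.
have S5 : \sum_(1 <= b < (4 * l).+1) ((b <= m)%N%:R * (128 * 2 ^+ i / l%:R)) <=
    m%:R * (128 * 2 ^+ i / l%:R) :> R.
  rewrite -mulr_suml; apply: ler_wpM2r => //; rewrite divr_ge0 ?mulr_ge0 ?exprn_ge0 // ltW.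
apply: le_trans (lerD S1 (lerD (le_trans S5 S3) S4)) _.
by lra.
Qed.

(** * Covering integers by few multiples *)

Local Open Scope ring_scope.

(** The factor [2 ^+ #|S|] of [count_large_sets], where [#|S| >= 2 ^ i / 2], beats the
    factor [expR (2 ^+ i / 8)] coming from [groups_inv_sum] by a geometric
    progression in the level [i]. *)
Lemma level_decay (R : realType) i :
  expR (2 ^+ i / 8 : R) * 2 ^+ i <= 4 * 2 ^+ (2 ^ i %/ 2).
Proof.
have e8 (x : R) : expR x * (1 - x) <= 1.
  rewrite -[leRHS](expRxMexpNx_1 x); apply: ler_wpM2l; [exact: expR_ge0 | exact: expR_ge1Dx].
case: i => [|i].
  rewrite !expr0 !mulr1 mul1r.
  by have := e8 8^-1; lra.
set n := (2 ^ i)%N; have -> : (2 ^ i.+1 %/ 2)%N = n by rewrite expnS mulKn.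
have -> : 2 ^+ i.+1 / 8 = 4^-1 * n%:R :> R by rewrite natrX exprS; field.
rewrite expRM_natr; have -> : 2 ^+ i.+1 = 2 * n%:R :> R by rewrite natrX exprS.
have e4 : expR (4^-1 : R) <= 4 / 3.
  by have := e8 4^-1; lra.
apply: (@le_trans _ _ ((4 / 3) ^+ n * (2 * n%:R))).
  apply: ler_wpM2r; first by rewrite mulr_ge0.
  by apply: lerXn2r; rewrite ?nnegrE ?expR_ge0 //; lra.
have H m : (2 + m%:R) * (4 / 3) ^+ m <= 2 * 2 ^+ m :> R.
  elim: m => [|m IH]; first by rewrite !expr0; lra.
  rewrite !exprS -natr1; have m0 : 0 <= m%:R :> R by [].
  have y0 : 0 <= (4 / 3) ^+ m :> R by rewrite exprn_ge0 //; lra.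
  move: IH y0 m0; set x := 2 ^+ m; set y := (4 / 3) ^+ m; set z := m%:R => IH y0 z0.
  have := mulr_ge0 z0 y0; lra.
have := H n; have y0 : 0 <= (4 / 3) ^+ n :> R by rewrite exprn_ge0 //; lra.
lra.
Qed.

(** Replace [u] by the product [D] of all the groups of primes that it hits, at the
    least level [i] for which at most [2 ^ i] groups are hit; then
    [D <= u * 2 ^ (l / 4)] by [group_prod_le]. Since level [i.-1] failed, more than
    [2 ^ i.-1] groups are hit, so [count_large_sets] bounds the number of possible
    sets of groups by [O(Y / ln Y)] times [2 ^- i], and the sum over [i] converges. *)
Lemma squarefree_cover (R : realType) : exists2 C : R, 0 < C &
  forall l X Y : nat, (1024 <= l)%N -> (X < 2 ^ (4 * l).+1)%N -> (0 < Y <= X)%N ->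
  exists DD : seq nat, (size DD)%:R * ln (Y%:R : R) <= C * Y%:R /\
   forall u, squarefree u -> (0 < u <= Y)%N ->
     exists2 D, D \in DD & [&& 0 < D, u %| D & D <= u * 2 ^ (l %/ 4)]%N.
Proof.
pose E : R := expR (2 + 32 * 1024); have E0 : 0 < E by apply: expR_gt0.
exists (72 * E); first by rewrite mulr_gt0.
move=> l X Y l1 XL /andP[Y0 YX].
pose fam i := [set S : {set 'I_X.+1 * 'I_X.+1} | [&& S \subset prime_groups X l i,
  \prod_(g in S) 2 ^ g.1 <= Y & 2 ^ i %/ 2 <= #|S| ]%N].
exists (flatten [seq [seq group_prod l i T | T <- enum (fam i)] | i <- iota 0 X.+1]); split.
  have -> : size (flatten [seq [seq group_prod l i T | T <- enum (fam i)] | i <- iota 0 X.+1])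
     = (\sum_(0 <= i < X.+1) #|fam i|)%N.
    rewrite size_flatten /shape -map_comp sumnE big_map /index_iota subn0.
    by apply: eq_bigr => i _ /=; rewrite size_map -cardE.
  have famle i : #|fam i|%:R * ln (Y%:R : R) <= 36 * E * Y%:R * (1 / 2 ^+ i).
    have v0 (g : 'I_X.+1 * 'I_X.+1) : (0 < 2 ^ g.1)%N by rewrite expn_gt0.
    have := @count_large_sets R _ (fun g : 'I_X.+1 * 'I_X.+1 => (2 ^ g.1)%N) (prime_groups X l i) 4 Y
       (2 ^ i %/ 2) v0 (groups_log_sum R X l i) (ler0n _ _) Y0.
    rewrite -/(fam i) mulrAC => h1.
    have h2 : expR (\sum_(g in prime_groups X l i) (2 : R) / (2 ^ g.1)%N%:R) <=
        expR (2 ^+ i / 8) * E.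
      by rewrite -expRD ler_expR; apply: groups_inv_sum.
    have h3 := level_decay R i.
    have p2 : 0 < 2 ^+ i :> R by rewrite exprn_gt0.
    have pr : 0 < 2 ^+ (2 ^ i %/ 2) :> R by rewrite exprn_gt0.
    rewrite mul1r ler_pdivlMr // -(ler_pM2r pr).
    have Y9 : 0 <= Y%:R * (1 + 2 * 4) :> R by rewrite mulr_ge0 //; lra.
    have := le_trans h1 (ler_wpM2l Y9 h2).
    have c0 : 0 <= Y%:R * (1 + 2 * 4) * E :> R by rewrite mulr_ge0 // ltW.
    have := ler_wpM2l c0 h3.
    move: h3 (ltW p2); set a := expR _; set b := 2 ^+ i; set r := 2 ^+ _; set c := _ * ln _.
    set f := Y%:R => _ b0 h4 h5.
    have := ler_wpM2r b0 h5; lra.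
  rewrite natr_sum mulr_suml.
  apply: (@le_trans _ _ (\sum_(0 <= i < X.+1) 36 * E * Y%:R * (1 / 2 ^+ i))).
    by apply: ler_sum => i _.
  rewrite -mulr_sumr.
  have : \sum_(0 <= i < X.+1) (1 : R) / 2 ^+ i <= 2.
    have := sum_inv_pow2 R X.+1; rewrite big_add1 /=.
    by under eq_bigr do rewrite exprS invfM mulrA divff ?pnatr_eq0 //.
  move/(ler_wpM2l (_ : 0 <= 36 * E * Y%:R)); rewrite mulr_ge0 ?mulr_ge0 ?(ltW E0) // => /(_ isT).
  by move/le_trans; apply; lra.
move=> u sq /andP[u0 uY]; have uX : (0 < u <= X)%N by rewrite u0 (leq_trans uY).
have exi : exists i, (#|hit_groups X l i u| <= 2 ^ i)%N.
  exists X; apply: leq_trans (leq_imset_card _ _) _.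
  by apply: leq_trans (max_card _) _; rewrite card_ord ltn_expl.
have [i few imin] := find_ex_minn exi.
have iX : (i <= X)%N.
  apply: imin; apply: leq_trans (leq_imset_card _ _) _.
  by apply: leq_trans (max_card _) _; rewrite card_ord ltn_expl.
have inF : hit_groups X l i u \in fam i.
  rewrite inE hit_groups_sub (leq_trans (hit_groups_weight _ _ sq uX)) //=.
  case: i few imin {iX} => [//|i] few imin; rewrite expnS mulKn //.
  apply: leq_trans (card_hit_groups_mono _ _ _ _).
  by rewrite leqNgt; apply/negP => /ltnW /imin; rewrite ltnn.
exists (group_prod l i (hit_groups X l i u)).
  apply/flattenP; exists [seq group_prod l i T | T <- enum (fam i)].
    by apply/mapP; exists i; rewrite // mem_iota add0n ltnS iX.
  by apply: map_f; rewrite mem_enum.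
rewrite group_prod_le // andbT group_prod_split // dvdn_mulr // andbT.
by rewrite -group_prod_split //; apply: prodn_cond_gt0 => p /andP[/prime_gt0].
Qed.

Local Open Scope nat_scope.

Lemma squarefree_decomp d : 0 < d ->
  exists a u, [/\ squarefree u, 0 < a, 0 < u & d = a ^ 2 * u].
Proof.
have [n] := ubnP d; elim: n d => // n IH d lt d0.
have [sq|nsq] := pselect (squarefree d); first by exists 1, d; rewrite mul1n.
have [p [pp lp]] : exists p, prime p /\ 1 < logn p d.
  apply: contrapT => H; apply: nsq => p pp; rewrite leqNgt; apply/negP => lp.
  by apply: H; exists p.
have : p ^ 2 %| d by rewrite pfactor_dvdn.
case/dvdnP => e Ed; rewrite Ed muln_gt0 in d0; case/andP: d0 => e0 p0.
have lte : e < n.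
  apply: leq_trans (_ : e < d) _; last by rewrite -ltnS.
  by rewrite Ed ltn_Pmulr // -(expn0 p) ltn_exp2l // prime_gt1.
have [a [u [sq a0 u0 Ee]]] := IH e lte e0.
exists (p * a), u; split=> //; first by rewrite muln_gt0 prime_gt0.
by rewrite Ed Ee expnMn mulnC mulnA.
Qed.

Lemma size_flatten_map (T : Type) (r : seq nat) (f : nat -> seq T) :
  size (flatten [seq f a | a <- r]) = \sum_(a <- r) size (f a).
Proof. by rewrite size_flatten /shape -map_comp sumnE big_map. Qed.

Lemma sqr_le_exp2 q : 16 <= q -> (4 * q + 4) ^ 2 <= 2 ^ q.
Proof.
move=> /subnKC <-; elim: (q - 16) => [//|j IH].
rewrite (addnS 16 j) [leqRHS]expnS; apply: leq_trans (leq_mul (leqnn 2) IH).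
have -> : 4 * (16 + j).+1 + 4 = (4 * (16 + j) + 4) + 4 by lia.
have : 68 <= 4 * (16 + j) + 4 by lia.
move: (4 * (16 + j) + 4) => y y68; rewrite -!mulnn.
have : 68 * y <= y * y by rewrite leq_mul2r y68 orbT.
by rewrite mulnDl !mulnDr; move: (y * y) => z; clear IH; lia.
Qed.

Local Open Scope ring_scope.

Lemma sum_inv_sqr (R : realType) m n : (0 < m)%N ->
  \sum_(m.+1 <= a < n.+1) (1 : R) / (a ^ 2)%N%:R <= 1 / m%:R.
Proof.
move=> m0; have m0' : 0 < m%:R :> R by rewrite ltr0n.
have key (x : R) : 0 < x -> - (1 / x) + 1 / (x + 1) ^+ 2 <= - (1 / (x + 1)).
  move=> x0; have hx : x != 0 by rewrite gt_eqF.
  have hx1 : x + 1 != 0 by rewrite gt_eqF //; lra.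
  rewrite -subr_ge0.
  have -> : - (1 / (x + 1)) - (- (1 / x) + 1 / (x + 1) ^+ 2) = 1 / (x * (x + 1) ^+ 2).
    by field; rewrite hx hx1.
  by rewrite divr_ge0 // mulr_ge0 ?exprn_ge0 //; lra.
have [mn|nm] := leqP m n; last by rewrite big_geq ?divr_ge0 // ltnW.
suff H : \sum_(m.+1 <= a < n.+1) (1 : R) / (a ^ 2)%N%:R <= 1 / m%:R - 1 / n%:R.
  by apply: le_trans H _; rewrite gerBl divr_ge0.
rewrite -(subnKC mn); elim: (n - m)%N => [|j IH].
  by rewrite addn0 big_geq // subrr.
rewrite addnS big_nat_recr /=; last by rewrite ltnS leq_addr.
have x0 : 0 < (m + j)%N%:R :> R by rewrite ltr0n addn_gt0 m0.
apply: le_trans (lerD IH (lexx _)) _; rewrite natrX -natr1.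
rewrite -addrA lerD2l; exact: key.
Qed.

Lemma ln2_ge (R : realType) : 1 / 2 <= ln (2 : R).
Proof.
have : ln (1 + (- (1 / 2)) : R) <= - (1 / 2) by apply: le_ln1Dx; lra.
have -> : 1 + - (1 / 2) = 2^-1 :> R by field.
by rewrite lnV ?posrE // lerN2.
Qed.

(** Every [d <= X] divides one of only [O(X / l)] numbers that are at most
    [2 ^ (l / 4)] times larger. Write [d = a ^ 2 * u] with [u] squarefree. For [a <= l]
    cover [u <= X / a ^ 2] by [squarefree_cover]; here [ln (X / a ^ 2)] is still of order
    [l], and the sum of [1 / a ^ 2] converges. The [d] with [a > l] number at most
    [X / l], and are taken as they are. *)
Lemma divisor_cover (R : realType) : exists2 C : R, 0 < C &
  forall l X : nat, (1024 <= l)%N -> (2 ^ (l %/ 2) <= X < 2 ^ (4 * l).+1)%N ->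
  exists DD : seq nat, (size DD)%:R * l%:R <= C * X%:R /\
   forall d, (0 < d <= X)%N ->
     exists2 D, D \in DD & [&& 0 < D, d %| D & D <= d * 2 ^ (l %/ 4)]%N.
Proof.
have [C C0 HC] := squarefree_cover R.
exists (32 * C + 1); first by lra.
move=> l X l1 /andP[Xl Xu].
have l0 : (0 < l)%N by apply: leq_trans l1.
have Y4 a : (0 < a <= l)%N -> (2 ^ (l %/ 4) <= X %/ a ^ 2 <= X)%N.
  move=> /andP[a0 al]; rewrite leq_div andbT leq_divRL ?expn_gt0 ?a0 //.
  apply: leq_trans Xl; apply: (@leq_trans (2 ^ (l %/ 4) * 2 ^ (l %/ 4))); last first.
    by rewrite -expnD leq_exp2l //; clear; lia.
  rewrite leq_mul2l; apply/orP; right; apply: leq_trans (sqr_le_exp2 _).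
    by rewrite leq_exp2r //; apply: leq_trans al _; clear; lia.
  by move: l1; clear; lia.
have fam a : exists DD : seq nat, (0 < a <= l)%N ->
   (size DD)%:R * l%:R <= 16 * C * X%:R * (1 / (a ^ 2)%N%:R) /\
   forall u, squarefree u -> (0 < u <= X %/ a ^ 2)%N ->
     exists2 D, D \in DD & [&& 0 < D, u %| D & D <= u * 2 ^ (l %/ 4)]%N.
  have [al|nal] := boolP (0 < a <= l)%N; last by exists [::].
  have /andP[y1 y2] := Y4 a al; have y0 : (0 < X %/ a ^ 2 <= X)%N.
    by rewrite y2 andbT; apply: leq_trans y1; rewrite expn_gt0.
  have [DD [sz cov]] := HC l X _ l1 Xu y0; exists DD => _; split=> //.
  case/andP: al => a0 _.
  have a0' : 0 < (a ^ 2)%N%:R :> R by rewrite ltr0n expn_gt0 a0.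
  have lnY : l%:R / 16 <= ln ((X %/ a ^ 2)%N%:R : R).
    apply: (@le_trans _ _ (ln ((2 ^ (l %/ 4))%N%:R : R))); last first.
      by rewrite ler_ln ?posrE ?ltr0n ?expn_gt0 ?ler_nat //; case/andP: y0.
    rewrite natrX lnXn // -mulr_natl.
    have h1 : l%:R / 8 <= (l %/ 4)%N%:R :> R.
      rewrite ler_pdivrMr // -natrM ler_nat; move: l1; clear; lia.
    have := ln2_ge R; have := ler_wpM2l (ler0n R (l %/ 4)%N) (ln2_ge R); lra.
  have le1 : (X %/ a ^ 2)%N%:R <= X%:R / (a ^ 2)%N%:R :> R.
    by rewrite ler_pdivlMr // -natrM ler_nat leq_trunc_div.
  have := ler_wpM2l (ler0n R (size DD)) lnY.
  have := ler_wpM2l (ltW C0) le1; move: sz; lra.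
have [F FP] := choice fam.
pose D1 := flatten [seq [seq a ^ 2 * D | D <- F a]%N | a <- iota 1 l].
pose D2 := flatten [seq [seq a ^ 2 * u | u <- iota 1 (X %/ a ^ 2)]%N | a <- iota l.+1 (X - l)].
exists (D1 ++ D2); split.
  have s1 : (size D1)%:R * l%:R <= 32 * C * X%:R.
    rewrite size_flatten_map natr_sum mulr_suml.
    apply: (@le_trans _ _ (\sum_(1 <= a < l.+1) 16 * C * X%:R * (1 / (a ^ 2)%N%:R))).
      rewrite /index_iota subn1 /= big_seq [leRHS]big_seq; apply: ler_sum => a.
      by rewrite mem_iota add1n ltnS size_map => /FP[].
    rewrite -mulr_sumr big_ltn // divr1.
    have := @sum_inv_sqr R 1 l isT; rewrite divr1 => h.
    have c0 : 0 <= 16 * C * X%:R by rewrite mulr_ge0 // mulr_ge0 // ltW.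
    have := ler_wpM2l c0 h; lra.
  have s2 : (size D2)%:R * l%:R <= X%:R :> R.
    have l0' : 0 < l%:R :> R by rewrite ltr0n.
    rewrite -(ler_pdivlMr _ _ l0') size_flatten_map natr_sum.
    apply: (@le_trans _ _ (\sum_(l.+1 <= a < X.+1) X%:R * (1 / (a ^ 2)%N%:R))).
      rewrite /index_iota subSS big_seq [leRHS]big_seq; apply: ler_sum => a.
      rewrite mem_iota size_map size_iota => /andP[la _].
      have a0' : 0 < (a ^ 2)%N%:R :> R by rewrite ltr0n expn_gt0 (leq_trans _ la).
      by rewrite mul1r ler_pdivlMr // -natrM ler_nat leq_trunc_div.
    rewrite -mulr_sumr; apply: ler_wpM2l => //; rewrite -[leRHS]mul1r.
    exact: sum_inv_sqr.
  by rewrite size_cat natrD; lra.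
move=> d /andP[d0 dX]; have [a [u [sq a0 u0 Ed]]] := squarefree_decomp d0.
have uX : (0 < u <= X %/ a ^ 2)%N.
  by rewrite u0 leq_divRL ?expn_gt0 ?a0 // mulnC -Ed.
have [al|la] := leqP a l.
  have al' : (0 < a <= l)%N by rewrite a0.
  have [_ /(_ u sq uX)[D Dm /and3P[D0' D1' D2']]] := FP a al'.
  exists (a ^ 2 * D)%N.
    rewrite mem_cat; apply/orP; left; apply/flattenP.
    exists [seq a ^ 2 * D | D <- F a]%N; last exact: map_f.
    by apply/mapP; exists a => //; rewrite mem_iota a0 add1n ltnS.
  by rewrite Ed dvdn_mul //= muln_gt0 expn_gt0 a0 D0' /= -mulnA leq_mul2l D2' orbT.
exists d; last by rewrite d0 dvdnn leq_pmulr // expn_gt0.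
rewrite mem_cat; apply/orP; right; apply/flattenP.
exists [seq a ^ 2 * u | u <- iota 1 (X %/ a ^ 2)]%N; last first.
  by rewrite Ed; apply: map_f; rewrite mem_iota add1n ltnS.
apply/mapP; exists a => //; rewrite mem_iota la /=.
have aX : (a <= X)%N.
  apply: leq_trans dX; rewrite Ed -mulnn -mulnA; apply: leq_pmulr.
  by rewrite muln_gt0 a0.
by rewrite addSn subnKC ?ltnS // (leq_trans (ltnW la)).
Qed.

(** * Reserving pairs of points for progressions *)

Local Open Scope nat_scope.

Lemma window_translates D w x : 0 < D ->
  count (fun q => (x + q) %% D < w) (iota 0 D) <= w.
Proof.
move=> D0; rewrite -size_filter -(size_map (fun q => (x + q) %% D)).
rewrite -[leqRHS](size_iota 0); apply: uniq_leq_size.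
  rewrite map_inj_in_uniq ?filter_uniq ?iota_uniq // => q r.
  rewrite !mem_filter !mem_iota !add0n => /andP[_ /andP[_ qD]] /andP[_ /andP[_ rD]] /eqP.
  by rewrite eqn_modDl !modn_small // => /eqP.
move=> _ /mapP[q + ->]; rewrite mem_filter => /andP[h _].
by rewrite mem_iota.
Qed.

Local Open Scope ring_scope.

(** Place the windows [{x | (x + q i) %% D i < w i}] one after the other. Averaging over
    the [D i] positions of window [i] shows that some position multiplies the
    potential [\sum_x 2 ^+ load x] by at most [1 + w i / D i]. The final potential
    bounds every single load. *)
Lemma balanced_windows (R : realType) (T : finType) (D w : T -> nat) (N : nat) :
  (forall i, 0 < D i)%N ->
  exists q : T -> nat, forall x, (x < N)%N ->
    2 ^+ #|[set i | (x + q i) %% D i < w i]%N| <= N%:R * expR (\sum_i (w i)%:R / (D i)%:R) :> R.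
Proof.
move=> D0.
suff [q Hq] : exists q : T -> nat,
    \sum_(x < N) 2 ^+ count (fun i => (x + q i) %% D i < w i)%N (enum T)
      <= N%:R * expR (\sum_(i <- enum T) (w i)%:R / (D i)%:R) :> R.
  exists q => x xN; rewrite big_enum in Hq; apply: le_trans Hq.
  rewrite (bigD1 (Ordinal xN)) //= -[leLHS]addr0; apply: lerD.
    rewrite le_eqVlt; apply/orP; left; apply/eqP; congr (_ ^+ _).
    by rewrite cardE -size_filter /enum_mem -filter_predI; congr size; apply: eq_filter => i; rewrite !inE andbT.
  by apply: sumr_ge0 => *; rewrite exprn_ge0.
elim: (enum T) (enum_uniq T) => [|i s IH] /=.
  move=> _; exists (fun=> 0%N); rewrite big_nil expR0 mulr1.
  by rewrite (eq_bigr (fun=> 1)) // sumr_const card_ord.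
case/andP=> is_ us; have {us IH} [q Hq] := IH us.
have D0' : 0 < (D i)%:R :> R by rewrite ltr0n.
pose old x : R := 2 ^+ count (fun i => (x + q i) %% D i < w i)%N s.
have [r rP] : exists r : nat, \sum_(x < N) old x * (1 + ((x + r) %% D i < w i)%N%:R)
     <= (1 + (w i)%:R / (D i)%:R) * \sum_(x < N) old x.
  apply: contrapT => no.
  have lt r : (1 + (w i)%:R / (D i)%:R) * \sum_(x < N) old x <
      \sum_(x < N) old x * (1 + ((x + r) %% D i < w i)%N%:R).
    by rewrite ltNge; apply/negP => le; apply: no; exists r.
  have : \sum_(0 <= r < D i) ((1 + (w i)%:R / (D i)%:R) * \sum_(x < N) old x) <
     \sum_(0 <= r < D i) \sum_(x < N) old x * (1 + ((x + r) %% D i < w i)%N%:R).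
    rewrite !big_mkord; apply: ltr_sum => //.
    by apply/hasP; exists (Ordinal (D0 i)) => //; rewrite mem_index_enum.
  rewrite sumr_const_nat subn0 exchange_big /= -[X in X < _]mulr_natr mulrAC [(1 + _) * _]mulrDl mul1r divfK ?gt_eqF //.
  rewrite mulr_sumr; apply/negP; rewrite -leNgt; apply: ler_sum => x _.
  rewrite -mulr_sumr [leRHS]mulrC; apply: ler_wpM2l; first by rewrite exprn_ge0.
  rewrite big_split /= sumr_const_nat subn0 lerD2l -natr_sum ler_nat.
  have := window_translates (w i) x (D0 i); rewrite -sum1_count big_mkcond /=.
  by rewrite /index_iota subn0; apply: leq_trans; apply: leq_sum => r _; case: ifP.
exists (fun j => if j == i then r else q j); rewrite big_cons expRD mulrCA.
have Es x : 2 ^+ (((x + (if i == i then r else q i)) %% D i < w i) +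
     count (fun j => (x + (if j == i then r else q j)) %% D j < w j) s)%N
   = old x * (1 + ((x + r) %% D i < w i)%N%:R) :> R.
  rewrite eqxx exprD mulrC; congr (_ * _); last by case: (_ < _)%N; rewrite ?expr0 ?expr1 ?addr0.
  congr (_ ^+ _); apply: eq_in_count => j js /=; rewrite ifN //.
  by apply: contraNneq is_ => <-.
under eq_bigr do rewrite Es.
apply: (le_trans rP); apply: ler_pM; last exact: Hq.
- by apply: addr_ge0 => //; apply: divr_ge0.
- by apply: sumr_ge0 => *; rewrite exprn_ge0.
- exact: expR_ge1Dx.
Qed.

Local Open Scope nat_scope.

Definition cell_points (N L D c q y : nat) : {set 'I_N} :=
  [set x : 'I_N | [&& c * L <= x, x < c.+1 * L & (x + q) %% D == y]].

Lemma card_cell_points (N L D c q y m : nat) :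
  y < D -> D * m <= L -> c.+1 * L <= N -> m <= #|cell_points N L D c q y|.
Proof.
move=> yD DL cN; have D0 : 0 < D by apply: leq_ltn_trans yD.
pose s := c * L + q; pose r := (y + (D - s %% D)) %% D.
have rD : r < D by rewrite ltn_pmod.
have sD : s %% D < D by rewrite ltn_pmod.
have rE : (s + r) %% D = y.
  rewrite /r modnDmr {1}(divn_eq s D).
  have -> : s %/ D * D + s %% D + (y + (D - s %% D)) = (s %/ D).+1 * D + y.
    by rewrite mulSn; move: (s %/ D * D) (s %% D) sD => a b; clear; lia.
  by rewrite modnMDl modn_small.
have bnd (j : 'I_m) : c * L + (j * D + r) < c.+1 * L.
  rewrite mulSn addnC ltn_add2r; apply: leq_trans DL; apply: leq_trans (_ : j.+1 * D <= _).
    by rewrite mulSn addnC ltn_add2r.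
  by rewrite mulnC leq_mul2l ltn_ord orbT.
pose f (j : 'I_m) : 'I_N := Ordinal (leq_trans (bnd j) cN).
have finj : injective f.
  move=> i j /(congr1 val) /= /eqP; rewrite eqn_add2l eqn_add2r eqn_pmul2r // => /eqP.
  exact: val_inj.
rewrite -[leqLHS]card_ord -(card_imset _ finj); apply: subset_leq_card.
apply/subsetP => _ /imsetP[j _ ->]; rewrite inE /= leq_addr bnd /=.
have -> : c * L + (j * D + r) + q = j * D + (s + r) by rewrite /s; clear; lia.
by rewrite modnMDl rE.
Qed.

(** A valid [e = (i, c, y)] requests two points of the [c]-th cell of length [L i] that
    satisfy [x + q i = y] modulo [D i]. It has at least [2 * m] candidates, while a point
    [x] is a candidate only for the requests of at most [m] indices [i], since [x]
    determines [c] and [y]; hence Hall's condition holds. The boolean distinguishes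
    the two points of a request. *)
Lemma assign_pairs (T : finType) (D w L q : T -> nat) (N m : nat) :
  0 < N -> 0 < m -> (forall i, 0 < L i) -> (forall i, w i <= D i) ->
  (forall i, D i * (2 * m) <= L i) ->
  (forall x, x < N -> #|[set i | (x + q i) %% D i < w i]| <= m) ->
  let valid (e : T * 'I_N * 'I_N) := (e.1.2.+1 * L e.1.1 <= N) && (e.2 < w e.1.1) in
  exists f : (T * 'I_N * 'I_N) * bool -> 'I_N,
    {in [pred e | valid e.1] &, injective f} /\
    forall e b, valid e -> f (e, b) \in cell_points N (L e.1.1) (D e.1.1) e.1.2 (q e.1.1) e.2.
Proof.
move=> N0 m0 L0 wD DL load valid.
pose nb (a : (T * 'I_N * 'I_N) * bool) :=
  cell_points N (L a.1.1.1) (D a.1.1.1) a.1.1.2 (q a.1.1.1) a.1.2.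
have [||x|f [fi fN]] := @hall_degree _ _ (Ordinal N0)
   [set a : (T * 'I_N * 'I_N) * bool | valid a.1] nb (2 * m); first by rewrite muln_gt0.
- move=> [[[i c] y] b]; rewrite inE /valid /nb /= => /andP[cN yw].
  by apply: card_cell_points => //; apply: leq_trans (wD i).
- pose ld := [set i | (x + q i) %% D i < w i].
  apply: (@leq_trans #|setX ld [set: bool]|); last first.
    by rewrite cardsX cardsT card_bool mulnC leq_mul2l load //=.
  rewrite -(@card_in_imset _ _ (fun a : (T * 'I_N * 'I_N) * bool => (a.1.1.1, a.2))).
    apply: subset_leq_card; apply/subsetP => _ /imsetP[[[[i c] y] b] + ->].
    rewrite !inE /valid /nb /= ?inE => /andP[/andP[_ yw] /and3P[_ _ /eqP E]].
    by rewrite andbT E.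
  have cE i (c : nat) : c * L i <= x -> x < c.+1 * L i -> c = x %/ L i.
    by move=> h1 h2; apply/eqP; rewrite eqn_leq leq_divRL // h1 -ltnS ltn_divLR // h2.
  move=> [[[i c] y] b] [[[i' c'] y'] b']; rewrite !inE /valid /nb /=.
  move=> /andP[_ /and3P[h1 h2 /eqP h3]] /andP[_ /and3P[h1' h2' /eqP h3']] [Ei Eb].
  rewrite -Ei in h1' h2' h3' *; congr (_, _, _, _) => //; apply: val_inj => /=.
    by rewrite (cE i c) // (cE i c').
  by rewrite -h3 -h3'.
exists f; split.
  by move=> a a' va va'; apply: fi; rewrite inE.
by move=> e b ve; apply: (fN (e, b)); rewrite inE.
Qed.

Lemma nth_pairs (X : eqType) (x0 : X) (l : seq (X * X)) r : r < size l ->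
  nth x0 (flatten [seq [:: p.1; p.2] | p <- l]) r.*2 = (nth (x0, x0) l r).1 /\
  nth x0 (flatten [seq [:: p.1; p.2] | p <- l]) r.*2.+1 = (nth (x0, x0) l r).2.
Proof. by elim: l r => // p l IH [|r] //=; rewrite ltnS => /IH. Qed.

Lemma count_halves t i : i < t -> count (fun j => j %/ 2 == i) (iota 0 (t * 2)) = 2.
Proof.
suff H n : count (fun j => j %/ 2 == i) (iota 0 (n * 2)) = (i < n) * 2.
  by move=> it; rewrite H it.
elim: n => [//|n IH]; rewrite mulSn addnC iotaD count_cat IH add0n /=.
have -> : n * 2 %/ 2 = n by rewrite mulnK.
have -> : (n * 2).+1 %/ 2 = n by rewrite -addn1 divnMDl // addn0.
by rewrite addn0 ltnS !(eq_sym n); case: (ltngtP i n).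
Qed.

(** List the prescribed pairs one after the other, then the remaining points, and give
    the points in positions [2 * i] and [2 * i + 1] the colour [i]. *)
Lemma pairs_coloring (A : finType) (P : {set A}) (t : nat) (g : A * bool -> 'I_(t * 2)) :
  0 < t -> {in [pred a | a.1 \in P] &, injective g} ->
  exists chi : nat -> 'I_t, equinumerous (t * 2) chi /\
    forall a, a \in P -> chi (g (a, false)).+1 = chi (g (a, true)).+1.
Proof.
move=> t0 gi.
have N0 : 0 < t * 2 by rewrite muln_gt0 t0.
pose x0 : 'I_(t * 2) := Ordinal N0.
pose l := [seq (g (a, false), g (a, true)) | a <- enum P].
pose s := flatten [seq [:: p.1; p.2] | p <- l].
have us : uniq s.
  have -> : s = [seq g ab | ab <- [seq (a, b) | a <- enum P, b <- [:: false; true]]].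
    rewrite /s /l; elim: (enum P) => //= a e -> //.
  have ue : uniq [seq (a, b) | a <- enum P, b <- [:: false; true]].
    by apply: allpairs_uniq; rewrite ?enum_uniq // => -[? ?] [? ?].
  rewrite map_inj_in_uniq //.
  move=> a b /allpairsP[[c d] [cP _ ->]] /allpairsP[[c' d'] [cP' _ ->]]; apply: gi; rewrite inE /=.
    by move: cP; rewrite mem_enum.
  by move: cP'; rewrite mem_enum.
pose s' := s ++ [seq x <- enum 'I_(t * 2) | x \notin s].
have us' : uniq s'.
  rewrite cat_uniq us filter_uniq ?enum_uniq // andbT /=.
  by apply/hasPn => x; rewrite mem_filter => /andP[].
have ps' : perm_eq s' (enum 'I_(t * 2)).
  apply: uniq_perm => //; first exact: enum_uniq.
  by move=> x; rewrite mem_cat mem_filter mem_enum andbT; case: (x \in s).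
have szs' : size s' = t * 2 by rewrite (perm_size ps') size_enum_ord.
pose h (x : 'I_(t * 2)) : nat := index x s' %/ 2.
have ht x : h x < t.
  rewrite /h ltn_divLR // -[X in _ < X]szs' index_mem (perm_mem ps') mem_enum //.
pose color (x : 'I_(t * 2)) : 'I_t := Ordinal (ht x).
exists (fun n => color (insubd x0 n.-1)); split.
  suff H i : count (fun x => color (insubd x0 x.-1) == i) (interval1 (t * 2)) = 2.
    by move=> i j; rewrite !H.
  have -> : interval1 (t * 2) = [seq 1 + x | x <- iota 0 (t * 2)] by rewrite -iotaDl.
  rewrite count_map -val_enum_ord count_map -(seq.permP ps').
  rewrite (@eq_in_count _ _ (fun x => index x s' %/ 2 == i)); last first.
    move=> x _ /=.
    have -> : insubd x0 (nat_of_ord x) = x by apply: val_inj; rewrite val_insubd ltn_ord.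
    by [].
  rewrite -[RHS](count_halves (ltn_ord i)) -(count_map (fun x => index x s') (fun j => j %/ 2 == i)).
  congr count; apply: (@eq_from_nth _ 0); first by rewrite size_map szs' size_iota.
  move=> j; rewrite size_map => js; rewrite (nth_map x0) // nth_iota ?add0n -?szs' //.
  by rewrite index_uniq.
move=> a aP; rewrite /= !valKd; apply: val_inj => /=; rewrite /h.
have al : index a (enum P) < size l by rewrite size_map index_mem mem_enum.
have [] := nth_pairs x0 al; rewrite (nth_map a) -?(size_map (fun a => (g (a, false), g (a, true)))) //.
rewrite nth_index ?mem_enum //= => E1 E2.
have szs : size s = (size l).*2.
  by rewrite /s; elim: (l) => //= p l' ->; rewrite doubleS.
have in1 : (index a (enum P)).*2 < size s by rewrite szs ltn_double.
have in2 : (index a (enum P)).*2.+1 < size s by rewrite szs ltn_Sdouble.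
rewrite -E1 -E2 /s' !index_cat !mem_nth // !index_uniq //.
by rewrite -muln2 mulnK // -addn1 divnMDl // addn0.
Qed.

Local Open Scope nat_scope.

(** Colour [2 * t] points in pairs. At scale [2 ^ sc] cut them into cells of length
    [k.-1 %/ 2 * 2 ^ sc], so that a progression with difference [d >= 2 ^ sc] contains
    all points of some cell that are congruent to its first term modulo [d]. If [d]
    divides [D i] and the window of [i] has length at least [d], then one of the
    residues [y] modulo [D i] in the window is congruent to that term, and both points
    reserved for [i], this cell and [y] lie on the progression. *)
Lemma not_forces_of_cover (R : realType) (T : finType) (sc D : T -> nat) (k t m : nat) :
  0 < t -> 2 < k -> 0 < m ->
  (forall i, 2 ^ (sc i).+1 <= D i) ->
  (forall i, D i * (2 * m) <= k.-1 %/ 2 * 2 ^ sc i) ->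
  ((t * 2)%N%:R * expR (\sum_i (2 ^ (sc i).+1)%N%:R / (D i)%:R) < 2 ^+ m.+1 :> R)%R ->
  (forall d, 0 < d -> k.-1 * d < t * 2 -> exists i, 2 ^ sc i <= d < 2 ^ (sc i).+1 /\ d %| D i) ->
  ~ forces_rainbow_AP k t.
Proof.
move=> t0 k2 m0 wD DL small cover forces.
set N := t * 2 in small cover; have N0 : 0 < N by rewrite muln_gt0 t0.
pose L i := k.-1 %/ 2 * 2 ^ sc i; pose w i := 2 ^ (sc i).+1.
have D0 i : 0 < D i by apply: leq_trans (wD i); rewrite expn_gt0.
have kh : 0 < k.-1 %/ 2 by move: k2; clear; lia.
have L0 i : 0 < L i by rewrite muln_gt0 kh expn_gt0.
have [q Hq] := balanced_windows R w N D0.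
have load x : x < N -> #|[set i | (x + q i) %% D i < w i]| <= m.
  move=> /Hq /le_lt_trans /(_ small); rewrite ltr_eXn2l ?ltr1n // ltnS.
have [f [fi fN]] := assign_pairs N0 m0 L0 wD DL load.
pose valid (e : T * 'I_N * 'I_N) := (e.1.2.+1 * L e.1.1 <= N) && (e.2 < w e.1.1).
pose P := [set e : T * 'I_N * 'I_N | valid e].
have fi' : {in [pred a | a.1 \in P] &, injective f}.
  by move=> a b; rewrite !inE => va vb; apply: fi.
have [chi [eqn same]] := pairs_coloring t0 fi'.
have [a [d [d0 sub un]]] := forces 2 isT chi eqn.
have inN s : s < k -> 0 < a + s * d <= N.
  move=> sk; have : a + s * d \in interval1 N.
    by apply: sub; apply: map_f; rewrite mem_iota.
  by rewrite mem_iota add1n ltnS.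
have k0 : 0 < k by apply: ltn_trans k2.
have /andP[a0 _] := inN 0 k0; rewrite mul0n addn0 in a0.
have /andP[_ aN] := inN k.-1 (etrans (congr1 (leq^~ k) (prednK k0)) (leqnn k)).
have dN : k.-1 * d < N by apply: leq_trans aN; rewrite -addn1 addnC leq_add2r.
have [i [/andP[d1 d2] dD]] := cover d d0 dN.
pose c := (a.-1 %/ L i).+1; pose y := (a.-1 + q i) %% d.
have yd : y < d by rewrite ltn_pmod.
have c1 : a.-1 < c * L i by rewrite /c ltn_ceil.
have c2 : c.+1 * L i <= a.-1 + k.-1 * d.
  rewrite /c 2!mulSn addnA addnC leq_add ?leq_trunc_div // addnn -muln2 /L.
  rewrite mulnAC; apply: leq_mul => //; exact: leq_trunc_div.
have cN : c.+1 * L i <= N.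
  by apply: leq_trans c2 _; apply: leq_trans aN; rewrite leq_add2r leq_pred.
have cN' : c < N by apply: leq_trans cN; rewrite leq_pmulr.
have yw : y < w i by apply: ltn_trans yd d2.
have yN : y < N.
  apply: leq_trans yw _; apply: leq_trans (wD i) _; apply: leq_trans cN.
  apply: leq_trans (_ : L i <= _); last by rewrite leq_pmull.
  by apply: leq_trans (DL i); rewrite leq_pmulr // muln_gt0.
pose e : T * 'I_N * 'I_N := (i, Ordinal cN', Ordinal yN).
have ve : valid e by rewrite /valid /= cN yw.
have pos b : exists s, [/\ s < k & (f (e, b)).+1 = a + s * d].
  have := fN e b ve; rewrite inE /= => /and3P[x1 x2 /eqP x3].
  set x := nat_of_ord (f (e, b)) in x1 x2 x3 *.
  have ax : a.-1 <= x by apply: leq_trans x1; apply: ltnW.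
  have xa : x <= a.-1 + k.-1 * d by apply: leq_trans c2; apply: ltnW.
  have : x == a.-1 %[mod d].
    rewrite -(eqn_modDr (q i)) -/y.
    by rewrite -(modn_dvdm _ dD) x3 modn_small.
  rewrite eqn_mod_dvd // => /dvdnP[s Es]; exists s.
  have Ex : x = a.-1 + s * d by rewrite -Es subnKC.
  split; last by rewrite Ex -addSn prednK.
  move: xa; rewrite Ex leq_add2l leq_pmul2r // => h.
  by rewrite -(prednK k0) ltnS.
have [s0 [s0k E0]] := pos false; have [s1 [s1k E1]] := pos true.
have ePP : e \in P by rewrite inE.
have := same e ePP; rewrite E0 E1 => Ec.
have : nth (chi 0) [seq chi x | x <- arith_prog a d k] s0 =
       nth (chi 0) [seq chi x | x <- arith_prog a d k] s1.
  by rewrite !(nth_map 0) ?size_map ?size_iota // !nth_iota.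
move/eqP; rewrite nth_uniq ?size_map ?size_iota // => /eqP Es.
have : f (e, false) = f (e, true).
  by apply: val_inj; apply: succn_inj; rewrite E0 E1 Es.
by move/fi => /(_ ve ve).
Qed.

(** * The lower bound *)

Local Open Scope ring_scope.

(** The numbers of [divisor_cover] for one dyadic scale of differences, multiplied
    so that all of them have size about [2 ^ (j + l / 2)]. At the scales below
    [2 ^ (l / 2)] all [d] are taken; their number is negligible. *)
Lemma scale_family (R : realType) : exists2 C : R, 0 < C &
  forall l j : nat, (1024 <= l)%N -> (j.+1 <= 4 * l)%N ->
  exists DD : seq nat,
   [/\ (size DD)%:R <= C / l%:R * 2 ^+ j.+1 + (if (j.+1 < l %/ 2)%N then 2 ^+ j.+1 else 0),
     {in DD, forall D, (2 ^ (j + l %/ 2) < 2 * D)%N /\ (D <= 2 ^ (j + l %/ 2))%N} &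
     forall d, (2 ^ j <= d < 2 ^ j.+1)%N -> exists2 D, D \in DD & (d %| D)%N].
Proof.
have [C C0 HC] := divisor_cover R; exists C => // l j l1 jl.
have l0 : 0 < l%:R :> R by rewrite ltr0n; apply: leq_trans l1.
suff [BB [szB covB]] : exists BB : seq nat,
    (size BB)%:R <= C / l%:R * 2 ^+ j.+1 + (if (j.+1 < l %/ 2)%N then 2 ^+ j.+1 else 0) :> R /\
    forall d, (2 ^ j <= d < 2 ^ j.+1)%N ->
      exists2 D, D \in BB & [&& 0 < D, d %| D & D <= d * 2 ^ (l %/ 4)]%N.
  pose B := (2 ^ (j + l %/ 2))%N.
  exists [seq (D * (B %/ D))%N | D <- BB & (0 < D <= B)%N]; split.
  - apply: le_trans szB; rewrite ler_nat size_map size_filter; exact: count_size.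
  - move=> _ /mapP[D + ->]; rewrite mem_filter => /andP[/andP[D0 DB] _].
    split; last by rewrite mulnC leq_trunc_div.
    rewrite -/B.
    have q0 : (0 < B %/ D)%N by rewrite divn_gt0.
    have := ltn_ceil B D0; rewrite mulSn => h; apply: leq_trans h _.
    by rewrite (mulnC D) mul2n -addnn leq_add2r leq_pmull.
  move=> d dj; have [D DB /and3P[D0 dD Dd]] := covB d dj; case/andP: dj => d1 d2.
  have d0 : (0 < d)%N by apply: leq_trans d1; rewrite expn_gt0.
  exists (D * (B %/ D))%N; last by rewrite dvdn_mulr.
  apply: map_f; rewrite mem_filter DB D0 andbT /= /B.
  apply: leq_trans Dd _; apply: leq_trans (leq_mul (ltnW d2) (leqnn _)) _.
  by rewrite -expnD leq_exp2l //; move: l1; clear; lia.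
have [jl2|jl2] := ltnP j.+1 (l %/ 2).
  exists (iota 1 (2 ^ j.+1)); split.
    by rewrite size_iota natrX lerDr mulr_ge0 ?exprn_ge0 // divr_ge0 // ltW.
  move=> d /andP[d1 d2]; have d0 : (0 < d)%N by rewrite (leq_trans _ d1) ?expn_gt0.
  exists d; last by rewrite d0 dvdnn leq_pmulr ?expn_gt0.
  by rewrite mem_iota add1n ltnS (ltnW d2) andbT (leq_trans _ d1) // expn_gt0.
have XX : (2 ^ (l %/ 2) <= 2 ^ j.+1 < 2 ^ (4 * l).+1)%N.
  by rewrite leq_exp2l // jl2 ltn_exp2l.
have [DD [sz cov]] := HC l _ l1 XX; exists DD; split.
  by rewrite addr0 mulrAC ler_pdivlMr // -natrX.
move=> d /andP[d1 d2]; apply: cov; rewrite (ltnW d2) andbT.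
by apply: leq_trans d1; rewrite expn_gt0.
Qed.

Lemma multi_scale_cover (R : realType) : exists2 C : R, 0 < C &
  forall l J : nat, (1024 <= l)%N -> (J.+1 <= 4 * l)%N ->
  exists Om : seq (nat * nat),
   [/\ (size Om)%:R <= 4 * C / l%:R * 2 ^+ J + 2 ^+ (l %/ 2),
     {in Om, forall p, (2 ^ (p.1 + l %/ 2) < 2 * p.2)%N /\ (p.2 <= 2 ^ (p.1 + l %/ 2))%N} &
     forall d, (0 < d < 2 ^ J.+1)%N ->
       exists2 p, p \in Om & (2 ^ p.1 <= d < 2 ^ p.1.+1)%N && (d %| p.2)%N].
Proof.
have [C C0 HC] := scale_family R; exists C => // l J l1 Jl.
have l0 : 0 < l%:R :> R by rewrite ltr0n; apply: leq_trans l1.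
have fam j : exists DD : seq nat, (j <= J)%N ->
   [/\ (size DD)%:R <= C / l%:R * 2 ^+ j.+1 + (if (j.+1 < l %/ 2)%N then 2 ^+ j.+1 else 0),
     {in DD, forall D, (2 ^ (j + l %/ 2) < 2 * D)%N /\ (D <= 2 ^ (j + l %/ 2))%N} &
     forall d, (2 ^ j <= d < 2 ^ j.+1)%N -> exists2 D, D \in DD & (d %| D)%N].
  have [jJ|Jj] := leqP j J; last by exists [::].
  by have [|DD H] := HC l j l1; [apply: leq_trans Jl | exists DD].
have [F FP] := choice fam.
exists (flatten [seq [seq (j, D) | D <- F j] | j <- iota 0 J.+1]); split.
- have -> : size (flatten [seq [seq (j, D) | D <- F j] | j <- iota 0 J.+1]) =
      (\sum_(0 <= j < J.+1) size (F j))%N.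
    by rewrite size_flatten_map; apply: eq_bigr => j _; rewrite size_map.
  rewrite natr_sum.
  apply: (@le_trans _ _ (\sum_(0 <= j < J.+1) (C / l%:R * 2 ^+ j.+1 +
      (if (j.+1 < l %/ 2)%N then 2 ^+ j.+1 else 0)))).
    rewrite big_nat [leRHS]big_nat; apply: ler_sum => j /andP[_ jJ].
    by have [] := FP j jJ.
  rewrite big_split /=; apply: lerD.
    rewrite -mulr_sumr.
    have -> : 4 * C / l%:R * 2 ^+ J = C / l%:R * (4 * 2 ^+ J).
      by move: (l%:R)^-1 (2 ^+ J) => v x; ring.
    apply: ler_wpM2l; first by rewrite divr_ge0 // ltW.
    elim: J {Jl fam F FP} => [|J IH]; first by rewrite big_nat1 expr0 expr1; lra.
    rewrite big_nat_recr //= !exprS; lra.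
  apply: (@le_trans _ _ (\sum_(0 <= j < J.+1) (if (j.+1 < l %/ 2)%N then 2 ^ j.+1 else 0)%N)%:R).
    rewrite natr_sum; apply: ler_sum => j _; case: ifP => //; by rewrite natrX.
  rewrite -natrX ler_nat; move: (l %/ 2)%N => h.
  suff H n : (\sum_(0 <= j < n) (if j.+1 < h then 2 ^ j.+1 else 0) <= 2 ^ minn n.+1 h)%N.
    by apply: leq_trans (H _) _; rewrite leq_exp2l // geq_minr.
  elim: n => [|n IH]; first by rewrite big_geq.
  rewrite big_nat_recr //=; case: ltnP => nh; last first.
    rewrite addn0; apply: leq_trans IH _; rewrite leq_exp2l //; clear; lia.
  have -> : minn n.+2 h = n.+2 by move: nh; clear; lia.
  have E : minn n.+1 h = n.+1 by move: nh; clear; lia.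
  by rewrite E in IH; rewrite [leqRHS]expnS mul2n -addnn leq_add2r.
- move=> p /flattenP[_ /mapP[j + ->] /mapP[D DF ->]].
  rewrite mem_iota add0n ltnS => /andP[_ jJ].
  by have [_ /(_ D DF) [h1 h2] _] := FP j jJ.
move=> d /andP[d0 dJ]; pose j := trunc_log 2 d.
have dj : (2 ^ j <= d < 2 ^ j.+1)%N by apply: trunc_log_bounds.
have jJ : (j <= J)%N.
  rewrite -ltnS -(ltn_exp2l (m := 2)) //; case/andP: dj => h _; exact: leq_ltn_trans dJ.
have [_ _ /(_ d dj) [D DF dD]] := FP j jJ.
exists (j, D); last by rewrite /= dj.
apply/flattenP; exists [seq (j, D) | D <- F j]; last exact: map_f.
by apply/mapP; exists j => //; rewrite mem_iota add0n ltnS.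
Qed.

Lemma trunc_log2_unbounded L : exists K : nat, forall k, (K <= k)%N -> (L <= trunc_log 2 k)%N.
Proof. by exists (2 ^ L)%N => k; apply: trunc_log_max. Qed.

(** Let [2 ^ l <= k < 2 ^ l.+1] and [be = 2 ^ (l / 2)], which is about the square root of
    [k]. The differences are at most [X], about [2 * t / k], so by [multi_scale_cover] the
    number of indices is at most [O(X / l) + be], which is at most [k / 128] when [t] is
    at most a small multiple of [k ^ 2 * ln k]. Cells then provide each request with
    [2 * m] candidates, where [m] is about [k / (4 * be)], while the logarithm of the
    potential in [balanced_windows] is at most [ln (2 * t) + k / (32 * be)], and
    [ln (2 * t) = O(l)] is much smaller than [be]. *)
Lemma rainbow_lower (R : realType) : exists (c : R) (K : nat), 0 < c /\
  forall k t : nat, (K <= k)%N -> (0 < t)%N ->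
    t%:R < c * (k%:R ^+ 2 * ln k%:R) -> ~ forces_rainbow_AP k t.
Proof.
have [C C0 HC] := multi_scale_cover R.
have [K1 HK1] := trunc_log2_unbounded 1024.
(* With e = 2 ^ -14 the bound on the number of indices is 32 * e * k = k / 512,
   plus lower order terms that fit into k / 128. *)
pose e : R := (128 * 128)^-1.
have e0 : 0 < e by rewrite invr_gt0 mulr_gt0.
have eE : 128 * (128 * e) = 1 by rewrite mulrA /e divff // mulf_neq0 // pnatr_eq0.
have eY y : 128 * (128 * (e * y)) = y.
  by transitivity (128 * (128 * e) * y); [rewrite !mulrA | rewrite eE mul1r].
have C1 : 0 < C + 1 by rewrite addr_gt0.
pose c : R := e / (C + 1).
have c0 : 0 < c by rewrite divr_gt0.
have cC : c * (C + 1) = e by rewrite /c divfK // gt_eqF.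
exists c, (maxn K1 (Num.bound (32 * (64 * C)))); split => // k t.
rewrite geq_max => /andP[/HK1 l1 kC] t0 small.
set l := trunc_log 2 k in l1.
have k0 : (0 < k)%N by case: (k) @l l1 => // l; rewrite /l trunc_log0.
have /andP[kl1 kl2] := trunc_log_bounds (isT : 1 < 2)%N k0.
rewrite -/l in kl1 kl2.
have {kC} kC : 32 * (64 * C) <= k%:R :> R.
  apply: le_trans (ltW (archi_boundP _)) _; first by rewrite !mulr_ge0 // ltW.
  by rewrite ler_nat.
have lnk : ln (k%:R : R) <= l.+1%:R.
  apply: (@le_trans _ _ (ln ((2 ^ l.+1)%N%:R : R))).
    by rewrite ler_ln ?posrE ?ltr0n ?expn_gt0 // ler_nat ltnW.
  by rewrite natrX lnXn // lerMn2r ln2_le1 orbT.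
pose h := (l %/ 2)%N; pose be := (2 ^ h)%N.
have be2 : (be * be <= k)%N.
  apply: leq_trans kl1; rewrite -expnD leq_exp2l // /h; clear; lia.
have beL : (4096 * l.+1 <= be)%N.
  have h512 : (512 <= h)%N by move: l1; rewrite /h; clear; lia.
  apply: leq_trans (sqr_le_exp2 (leq_trans _ h512)) => //.
  have lh : (2 * l.+1 <= 4 * h + 4)%N by rewrite /h; clear; lia.
  rewrite -mulnn; apply: leq_trans (leq_mul (_ : 2048 <= 4 * h + 4)%N lh).
    by rewrite mulnA.
  by move: h512; clear; lia.
have be0 : (0 < be)%N by rewrite expn_gt0.
have be8 : (8 <= be)%N by apply: leq_trans beL; rewrite mulnS; clear; lia.
pose ka := (k.-1 %/ 2)%N; pose m := (ka %/ (2 * be))%N.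
have k8 : (64 <= k)%N by apply: leq_trans (leq_mul be8 be8) be2.
have k1 : (0 < k.-1)%N by move: k8; clear; lia.
have k4 : (k <= 4 * ka)%N.
  by move: k8; rewrite /ka; clear; lia.
have m0 : (0 < m)%N.
  rewrite divn_gt0 ?muln_gt0 //.
  have : (8 * be <= be * be)%N by rewrite leq_mul2r be8 orbT.
  by move: be2 k4; move: (be * be)%N => z; clear; lia.
pose X := (t * 2 %/ k.-1).+1; pose J := trunc_log 2 X.
have /andP[JX XJ] := trunc_log_bounds (isT : 1 < 2)%N (isT : (0 < X)%N).
rewrite -/J in JX XJ.
have k0' : 0 < k%:R :> R by rewrite ltr0n.
have tk : t%:R <= c * (k%:R ^+ 2 * l.+1%:R).
  apply: le_trans (ltW small) _; apply: ler_wpM2l; first exact: ltW.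
  by apply: ler_wpM2l => //; rewrite exprn_ge0.
have c1 : c <= e by rewrite -cC ler_peMr ?(ltW c0) // lerDr ltW.
clearbody e.
have cY y : 0 <= y -> 128 * (128 * (c * y)) <= y.
  move=> y0; rewrite -[leRHS]eY; do 2 (apply: ler_wpM2l => //).
  exact: ler_wpM2r.
clearbody c.
have Xk : X%:R <= 4 * c * k%:R * l.+1%:R + 1.
  have h1 : (k * (t * 2 %/ k.-1) <= 4 * t)%N.
    have := leq_trunc_div (t * 2) k.-1; move: k8; move: (_ %/ _)%N => x; clear; nia.
  rewrite /X -natr1 lerD2r -(ler_pM2l k0').
  apply: (@le_trans _ _ (4 * t%:R)); first by rewrite -!natrM ler_nat.
  have -> : k%:R * (4 * c * k%:R * l.+1%:R) = 4 * (c * (k%:R ^+ 2 * l.+1%:R)).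
    by rewrite expr2; ring.
  exact: ler_wpM2l.
have Jl : (J.+1 <= 4 * l)%N.
  have h1 : (X <= k * l.+1)%N.
    rewrite -(ler_nat R) natrM; apply: (le_trans Xk).
    have h2 : 2 <= k%:R * l.+1%:R :> R.
      rewrite -natrM ler_nat; apply: leq_trans (leq_pmulr _ _) => //.
      by apply: leq_trans k8.
    have := cY _ (le_trans (ler0n R 2) h2); move: h2; rewrite -!mulrA.
    by move: (k%:R * _) => y; clear; lra.
  have h2 : (2 ^ J < 2 ^ (l.+1 + l.+1))%N.
    apply: leq_ltn_trans JX _; apply: leq_ltn_trans h1 _; rewrite expnD.
    by apply: ltn_mul => //; apply: ltn_expl.
  by move: h2 l1; rewrite ltn_exp2l //; clear; lia.
have [Om [szO bO covO]] := HC l J l1 Jl; rewrite -/h in szO bO.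
have szk : (size Om)%:R <= k%:R / 128 :> R.
  have l0 : 1 <= l%:R :> R by rewrite ler1n (leq_trans _ l1).
  have beR : 512 * be%:R <= k%:R :> R.
    rewrite -natrM ler_nat; apply: leq_trans be2; rewrite leq_mul2r; apply/orP; right.
    by apply: leq_trans beL; move: l1; clear; lia.
  have JR : 2 ^+ J <= X%:R :> R by rewrite -natrX ler_nat.
  have h1 : 4 * C / l%:R * 2 ^+ J <= k%:R / 256.
    rewrite mulrAC ler_pdivrMr; last exact: lt_le_trans l0.
    have C4 : 0 <= 4 * C by rewrite mulr_ge0 // ltW.
    apply: (le_trans (ler_wpM2l C4 (le_trans JR Xk))).
    have cCk : c * C * (k%:R * l.+1%:R) <= e * (k%:R * l.+1%:R).
      by apply: ler_wpM2r; rewrite ?mulr_ge0 // -cC ler_wpM2l ?(ltW c0) // lerDl.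
    have kl : k%:R <= k%:R * l%:R :> R by rewrite ler_peMr // ltW.
    move: cCk (eY (k%:R * l.+1%:R)); rewrite -natr1 => cCk ek.
    by clear -cCk ek kl kC; lra.
  apply: (le_trans szO); have -> : 2 ^+ h = be%:R :> R by rewrite natrX.
  move: h1 beR; move: (_ * 2 ^+ J) (be%:R) => u v h1 beR.
  by clear -h1 beR k0'; lra.
pose sc (i : 'I_(size Om)) := (nth (0, 0)%N Om i).1.
pose D (i : 'I_(size Om)) := (nth (0, 0)%N Om i).2.
have bD i : (2 ^ sc i * be < 2 * D i)%N /\ (D i <= 2 ^ sc i * be)%N.
  by rewrite /be -expnD; apply: bO; apply: mem_nth.
apply: (@not_forces_of_cover R _ sc D k t m) => //.
- by apply: leq_trans k8.
- move=> i; have [h1 h2] := bD i.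
  have h3 : (2 ^ sc i * 4 <= 2 ^ sc i * be)%N by rewrite leq_mul2l (leq_trans _ be8) ?orbT.
  by move: h1 h3; rewrite expnS; move: (2 ^ sc i)%N (_ * be)%N (D i) => a b u; clear; lia.
- move=> i; have [h1 h2] := bD i; apply: leq_trans (leq_mul h2 (leqnn _)) _.
  rewrite -mulnA mulnC leq_mul2r; apply/orP; right.
  by rewrite mulnCA mulnA mulnC leq_trunc_div.
- have be0' : 0 < be%:R :> R by rewrite ltr0n.
  have s1 : \sum_i (2 ^ (sc i).+1)%N%:R / (D i)%:R <= k%:R / (32 * be%:R) :> R.
    apply: (@le_trans _ _ (\sum_(i < size Om) 4 / be%:R)).
      apply: ler_sum => i _; have [h1 _] := bD i.
      have Di : 0 < (D i)%:R :> R by rewrite ltr0n; case: (D i) h1.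
      rewrite ler_pdivrMr // mulrAC ler_pdivlMr // -!natrM ler_nat expnS.
      by move: h1; rewrite -mulnA; move: (2 ^ sc i * be)%N (D i) => a b; clear; lia.
    rewrite sumr_const card_ord -[X in X <= _]mulr_natr mulrAC ler_pdivrMr //.
    have -> : k%:R / (32 * be%:R) * be%:R = k%:R / 32 :> R.
      by move: be0'; move: (be%:R) => b b0; field; rewrite gt_eqF.
    by clear -szk; lra.
  have m1 : k%:R / (16 * be%:R) < m.+1%:R * ln 2 :> R.
    have h1 : k%:R < 8 * be%:R * m.+1%:R :> R.
      rewrite -!natrM ltr_nat; apply: leq_ltn_trans k4 _.
      have := ltn_ceil ka (_ : 0 < 2 * be)%N; rewrite muln_gt0 be0 => /(_ isT).
      by rewrite -/m -[(8 * be)%N]/((4 * 2) * be)%N -!mulnA ltn_pmul2l // mulnC mulnA.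
    rewrite ltr_pdivrMr; last by rewrite mulr_gt0.
    have := ler_wpM2l (ler0n R m.+1) (ln2_ge R).
    move=> h2; have h3 : 0 <= be%:R :> R by exact: ltW.
    have := ler_wpM2l h3 h2; clear -h1; lra.
  have lt : ln ((t * 2)%N%:R : R) <= 3 * l.+1%:R.
    apply: (@le_trans _ _ (ln ((2 ^ (3 * l.+1))%N%:R : R))); last first.
      rewrite natrX lnXn // -[X in X <= _]mulr_natr mulrC natrM; apply: (@le_trans _ _ (3 * l.+1%:R * 1)).
        by apply: ler_wpM2l; [rewrite mulr_ge0 | exact: ln2_le1].
      by rewrite mulr1.
    rewrite ler_ln ?posrE ?ltr0n ?expn_gt0 ?muln_gt0 ?t0 // ler_nat.
    have h1 : (t * 2 <= k * k * l.+1)%N.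
      rewrite -(ler_nat R) !natrM.
      have y0 : 0 <= k%:R ^+ 2 * l.+1%:R :> R by rewrite mulr_ge0 // exprn_ge0.
      have cy := cY _ y0; move: tk cy y0; rewrite expr2; move: (k%:R * k%:R * _) => y.
      by clear; lra.
    apply: (leq_trans h1); rewrite mulnC expnM.
    have -> : ((2 ^ 3) ^ l.+1)%N = (2 ^ l.+1 * (2 ^ l.+1 * 2 ^ l.+1))%N.
      by rewrite -!expnMn.
    by apply: leq_mul; [apply/ltnW/ltn_expl | apply: leq_mul; apply: ltnW].
  have t2 : 0 < (t * 2)%N%:R :> R by rewrite ltr0n muln_gt0 t0.
  rewrite -[X in X * expR _]lnK ?posrE // -expRD.
  have -> : 2 ^+ m.+1 = expR (m.+1%:R * ln 2) :> R.
    by rewrite expRM_natl lnK ?posrE.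
  rewrite ltr_expR.
  have h3 : 3 * l.+1%:R <= k%:R / (32 * be%:R) :> R.
    rewrite ler_pdivlMr ?mulr_gt0 // -!natrM ler_nat.
    apply: leq_trans be2; rewrite mulnA leq_mul2r; apply/orP; right.
    by apply: leq_trans beL; clear; lia.
  have h4 : k%:R / (16 * be%:R) = k%:R / (32 * be%:R) + k%:R / (32 * be%:R) :> R.
    by move: be0'; move: (be%:R) => b b0; field; rewrite gt_eqF.
  by apply: le_lt_trans (lerD (le_trans lt h3) s1) _; rewrite -h4.
move=> d d0 dt; have dX : (0 < d < 2 ^ J.+1)%N.
  rewrite d0; apply: leq_ltn_trans XJ; rewrite /X; apply: leqW.
  by rewrite leq_divRL // mulnC ltnW.
have [p pO /andP[pd dp]] := covO d dX.
have pi : (index p Om < size Om)%N by rewrite index_mem.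
by exists (Ordinal pi); rewrite /sc /D /= nth_index.
Qed.

(** * The rainbow number *)

Local Open Scope nat_scope.

Lemma rainbow_number_spec k t : 0 < t -> forces_rainbow_AP k t ->
  is_rainbow_number k (rainbow_number k).
Proof.
move=> t0 ft.
have exP : exists s, `[< 0 < s /\ forces_rainbow_AP k s >] by exists t; apply/asboolP.
have [r /asboolP[r0 fr] rmin] := find_ex_minn exP.
apply: xgetPex; exists r; split=> // s s0 fs.
by apply: rmin; apply/asboolP.
Qed.

Local Open Scope ring_scope.

Lemma rainbow_number_bounds (R : realType) :
  exists c C : R, [/\ 0 < c, 0 < C &
     exists K : nat, forall k : nat, (K <= k)%N ->
       c * (k%:R ^+ 2 * ln k%:R) <= (rainbow_number k)%:R
         <= C * (k%:R ^+ 2 * ln k%:R)].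
Proof.
have [C [K1 [C0 up]]] := rainbow_upper R.
have [c [K2 [c0 low]]] := rainbow_lower R.
exists c, C; split=> //; exists (maxn K1 K2) => k; rewrite geq_max => /andP[k1 k2].
have [t [t0 ft tC]] := up k k1.
have [r0 fr rmin] := rainbow_number_spec t0 ft.
apply/andP; split; last by apply: le_trans tC; rewrite ler_nat rmin.
by rewrite leNgt; apply/negP => /(low k _ k2 r0).
Qed.

Local Open Scope classical_set_scope.
Local Open Scope ring_scope.

Theorem theorem1 (R : realType) :
  (exists c C : R, [/\ 0 < c, 0 < C &
     exists K : nat, forall k : nat, (K <= k)%N ->
       c * (k%:R ^+ 2 * ln k%:R) <= (rainbow_number k)%:R
         <= C * (k%:R ^+ 2 * ln k%:R)])
  /\ (fun k : nat => (rainbow_number k)%:R : R^o)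
       =Theta_\oo (fun k : nat => k%:R ^+ 2 * ln k%:R : R^o).
Proof.
have bounds := rainbow_number_bounds R; split=> //.
have [c [C [c0 C0 [K HK]]]] := bounds.
rewrite eqThetaE qualifE; apply/asboolP; exists (c, C); first by rewrite /= c0.
near=> k; have /HK/andP[lo hi] : (K <= k)%N by near: k; exact: nbhs_infty_ge.
have pos : 0 <= k%:R ^+ 2 * ln k%:R :> R by rewrite mulr_ge0 ?exprn_ge0 ?lnn_ge0.
by rewrite /= !ger0_norm.
Unshelve. all: by end_near.
Qed.
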